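(* For any $\varphi\in L^1(\mathbb{R}^d)$ with $0\leqslant \varphi\leqslant 1$, there exists a positive constant $C(\varphi)$ such that, as functions on $\widehat{\mathbb{R}^d}$, $$t^{d/2}\, \big|e^{t(1-q_1)}\, \mathbf{H}_t \widehat \varphi - \widehat{C(\varphi)}\; \mathbf{P}_t\widehat \varphi\big| \leqslant l_1\, o(1),$$ where $o(1)$ is a function of $t$ only, tending to $0$ as $t\to\infty$.
   Context: $d\geqslant1$ is an integer. $(q_k)_{k\geqslant 1}$ is a sequence of nonnegative numbers with $\sum_{k\geqslant 1}q_k=1$ and $1<\sum_{k\geqslant 1}kq_k<\infty$. Configurations: $E=\mathbb{R}^d$ and $\widehat{E}=\widehat{\mathbb{R}^d}$ is the set of all finite sums of Dirac measures $\sum_{1\leqslant k\leqslant k_0}\delta_{x_k}$, $k_0\geqslant1$, $x_k\in E$, together with the zero measure $\mathbf{0}$. It is identified with $\bigcup_{m\geqslant 0}E^{(m)}$, where $E^{(m)}$ is the $m$-th symmetric power of $E$ and $E^{(0)}=\{\mathbf{0}\}$, endowed with the disjoint-union topology and its Borel $\sigma$-algebra. The function $l_1:\widehat E\to\mathbb{R}$ equals $k$ on $E^{(k)}$, $k\geqslant 0$. For a nonnegative Borel function $\psi$ on $E$ (in particular a nonnegative constant), the multiplicative function $\widehat{\psi}:\widehat E\to\mathbb{R}_+$ is $\widehat{\psi}(\sum_{k}\delta_{x_k})=\prod_k\psi(x_k)$ and $\widehat\psi(\mathbf{0})=1$. $(\mathbf{P}_t)_{t\geqslant0}$ is the transition function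 of the Brownian motion $\widehat B$ on $\widehat{\mathbb{R}^d}$ induced by the $d$-dimensional Brownian motion: on $E^{(k)}$ it is the symmetrization (projection to $E^{(k)}$) of the $k$-fold product of the $d$-dimensional Wiener (heat) semigroup $(P_t)$, i.e. $k$ particles move as $k$ independent Brownian motions; in particular $\mathbf{P}_t\widehat\varphi=\widehat{P_t\varphi}$. In the paper's normalization $(P_t)$ is the semigroup with generator $\Delta$, $P_t\varphi=K_t*\varphi$, with $K_t$ the heat kernel. $(\mathbf{H}_t)_{t\geqslant0}$ is the transition function of the branching process $\widehat X$ on $\widehat{\mathbb{R}^d}$ (a Markov process such that, for all $\mu_1,\mu_2\in\widehat E$, the process started from $\mu_1+\mu_2$ is equal in distribution to the sum of independent copies started from $\mu_1$ and from $\mu_2$) characterized by $\mathbf{H}_t\widehat\varphi=\widehat{u(\cdot,t)}$ for all Borel $\varphi$ with $0\leqslant\varphi\leqslant1$, where $u$ is the unique global mild solution with values in $[0,1]$ of $u_t=\Delta u-u+\sum_{k\geqslant1}q_ku^k$, $u(\cdot,0)=\varphi$.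
   Formalization: The inequality is stated on all nonzero configurations only: at the zero measure l_1 = 0 and both functions equal 1, so it would read t^{d/2}|e^{t(1-q_1)} - 1| ≤ 0, which is false for every t > 0 since q_1 < 1. *)

(* Defs.v *)
From HB Require Import structures.
From mathcomp Require Import all_boot all_order all_algebra.
From mathcomp Require Import finmap multiset.
From mathcomp Require Import all_classical all_reals all_analysis measurable_realfun.

Set Implicit Arguments.
Unset Strict Implicit.
Unset Printing Implicit Defensive.

Import Order.TTheory GRing.Theory Num.Theory.
Import numFieldNormedType.Exports.

Local Open Scope classical_set_scope.
Local Open Scope ring_scope.

Definition mx_borel_display : measure_display.
Proof. exact: default_measure_display. Qed.

Section mx_borel.
Variables (R : realType) (m n : nat).

Definition mx_borel : set (set 'M[R]_(m, n)) := <<s [set U | open U] >>.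

Let mx_borel0 : mx_borel set0. Proof. exact: sigma_algebra0. Qed.

Let mx_borelC A : mx_borel A -> mx_borel (~` A).
Proof. exact: sigma_algebraC. Qed.

Let mx_borel_bigcup (F : (set 'M[R]_(m, n))^nat) :
  (forall i, mx_borel (F i)) -> mx_borel (\bigcup_i F i).
Proof. exact: sigma_algebra_bigcup. Qed.

HB.instance Definition _ := @isMeasurable.Build mx_borel_display 'M[R]_(m, n)
  mx_borel mx_borel0 mx_borelC mx_borel_bigcup.

End mx_borel.

Section mx_borel_theory.
Variables (R : realType) (m n : nat).

Lemma measurable_mx_coord (i : 'I_m) (j : 'I_n) :
  measurable_fun [set: 'M[R]_(m, n)] (fun M => M i j : R).
Proof.
apply: (measurability _ (RGenOInfty.measurableE R)) => _ [_ [a ->] <-].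
rewrite setTI; apply: sub_sigma_algebra => /=.
apply: open_comp; first by move=> M _; exact: coord_continuous.
exact: interval_open.
Qed.

Lemma mx_open_bigcup (U : set 'M[R]_(m, n)) : open U ->
  exists I : set ('M[rat]_(m, n) * nat),
  U = \bigcup_(ck in I)
        [set M | forall i j, `|ratr (ck.1 i j) - M i j| < ck.2.+1%:R^-1].
Proof.
move=> oU; set B := fun ck : 'M[rat]_(m, n) * nat => [set M : 'M[R]_(m, n) |
  forall i j, `|ratr (ck.1 i j) - M i j| < ck.2.+1%:R^-1].
exists [set ck | B ck `<=` U]; apply/seteqP; split; last first.
  by move=> M [ck /= BU /BU].
move=> M UM; have /nbhs_ballP[e /= e0 eU] : nbhs M U by exact: open_nbhs_nbhs.
have [k ke] : exists k : nat, k.+1%:R^-1 < e / 2.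
  have /filter_ex[k /= kP] := near_infty_natSinv_lt (PosNum (divr_gt0 e0 (ltr0n R 2))).
  by exists k.
have k0 : (0 : R) < k.+1%:R^-1 by rewrite invr_gt0 ltr0n.
have ex_c i j : exists c : rat, `|ratr c - M i j| < k.+1%:R^-1.
  have /rat_in_itvoo[c] : M i j - k.+1%:R^-1 < M i j + k.+1%:R^-1 :> R.
    by rewrite ltrBlDr -addrA ltrDl addr_gt0.
  by rewrite in_itv /= => cP; exists c; rewrite ltr_distl.
pose c := \matrix_(i, j) sval (cid (ex_c i j)).
have cP i j : `|ratr (c i j) - M i j| < k.+1%:R^-1.
  by rewrite mxE; exact: (svalP (cid (ex_c i j))).
exists (c, k) => //= N BN; apply: eU; split => // i j.
rewrite /ball /= (splitr e) (le_lt_trans (ler_distD (ratr (c i j)) _ _))//.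
by rewrite ltrD// ?(lt_trans (BN i j))// distrC (lt_trans (cP i j)).
Qed.

Lemma measurable_fun_mx d (T : measurableType d) (f : T -> 'M[R]_(m, n)) :
  (forall i j, measurable_fun [set: T] (fun x => f x i j)) ->
  measurable_fun [set: T] f.
Proof.
move=> mf; apply: (measurability [set U : set 'M[R]_(m, n) | open U]) => //.
move=> _ [U /mx_open_bigcup[I ->] <-]; rewrite setTI preimage_bigcup.
rewrite bigcup_mkcond; apply: countable_bigcupT_measurable => // -[c k].
case: ifPn => // _.
rewrite (_ : _ @^-1` _ = \bigcap_(ij in [set: 'I_m * 'I_n])
    [set x | `|ratr (c ij.1 ij.2) - f x ij.1 ij.2| < k.+1%:R^-1]); last first.
  apply/seteqP; split => x /= H; first by move=> [i j] _; exact: H.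
  by move=> i j; exact: (H (i, j)).
apply: fin_bigcap_measurable => // -[i j] _ /=.
have mg : measurable_fun [set: T] (fun x => `|ratr (c i j) - f x i j|).
  by apply: measurableT_comp => //; exact: measurable_funB.
rewrite -[X in measurable X]setTI (_ : [set _ | _] =
  (fun x => `|ratr (c i j) - f x i j|) @^-1` `]-oo, k.+1%:R^-1[%classic).
  exact: mg.
by apply/seteqP; split => x /=; rewrite in_itv.
Qed.

End mx_borel_theory.

Definition config (R : realType) (d : nat) : Type := {mset 'rV[R]_d}%mset.

HB.instance Definition _ (R : realType) (d : nat) :=
  Choice.copy (config R d) (multiset 'rV[R]_d).
HB.instance Definition _ (R : realType) (d : nat) :=
  isPointed.Build (config R d) (@mset0 'rV[R]_d).

Definition config_display : measure_display.
Proof. exact: default_measure_display. Qed.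

Section config.
Variables (R : realType) (d : nat).
Local Notation E := 'rV[R]_d.
Local Notation Ehat := (config R d).

(* The canonical projection E^m -> E^(m); a point of E^m is the matrix of its
   m rows, so that the topology of 'M[R]_(m, d) is the product one. *)
Definition config_of_mx (m : nat) (M : 'M[R]_(m, d)) : Ehat :=
  seq_mset [seq row i M | i <- enum 'I_m].

(* Disjoint union of the quotient topologies of the E^(m). *)
Definition config_open (U : set Ehat) : Prop :=
  forall m : nat, open [set M : 'M[R]_(m, d) | U (config_of_mx M)].

Definition config_borel : set (set Ehat) := <<s config_open >>.

Let config_borel0 : config_borel set0. Proof. exact: sigma_algebra0. Qed.

Let config_borelC A : config_borel A -> config_borel (~` A).
Proof. exact: sigma_algebraC. Qed.

Let config_borel_bigcup (F : (set Ehat)^nat) :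
  (forall i, config_borel (F i)) -> config_borel (\bigcup_i F i).
Proof. exact: sigma_algebra_bigcup. Qed.

HB.instance Definition _ := @isMeasurable.Build config_display Ehat
  config_borel config_borel0 config_borelC config_borel_bigcup.

Definition config_of_tuple (k : nat) (s : k.-tuple E) : Ehat := seq_mset s.

Lemma measurable_config_of_tuple (k : nat) :
  measurable_fun [set: k.-tuple E] (@config_of_tuple k).
Proof.
pose f (s : k.-tuple E) : 'M[R]_(k, d) := \matrix_(i, j) tnth s i 0 j.
have mf : measurable_fun setT f.
  apply: measurable_fun_mx => i j; under eq_fun do rewrite mxE.
  apply: (@measurableT_comp _ _ _ _ _ _ (fun M : E => M 0 j)).
    exact: measurable_mx_coord.
  exact: measurable_tnth.
have fE s : config_of_tuple s = config_of_mx (f s).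
  rewrite /config_of_mx /config_of_tuple; congr seq_mset.
  rewrite -[LHS]map_tnth_enum; apply: eq_map => i.
  by apply/rowP => j; rewrite !mxE.
apply: (measurability config_open) => // _ [U oU <-]; rewrite setTI.
rewrite (_ : _ @^-1` U = f @^-1` [set M | U (config_of_mx M)]).
  by rewrite -[X in measurable X]setTI; apply: mf => //;
    apply: sub_sigma_algebra; exact: oU.
by apply/seteqP; split => s /=; rewrite fE.
Qed.

Definition l1 (mu : Ehat) : nat := size (enum_mset mu).

Definition hat (psi : E -> R) (mu : Ehat) : R :=
  \prod_(x <- enum_mset mu) psi x.

Definition config_add (mu nu : Ehat) : Ehat := (mu `+` nu)%mset.

End config.

Lemma sigma_finite_pushforward d1 d2 (T1 : measurableType d1)
    (T2 : measurableType d2) (R : realType) (m : set T1 -> \bar R)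
    (f : T1 -> T2) (g : T2 -> T1) :
  measurable_fun setT g -> cancel f g ->
  sigma_finite setT m -> sigma_finite setT (pushforward m f).
Proof.
move=> mg fK [F FT mF]; exists (fun n => g @^-1` F n).
  by rewrite -preimage_bigcup -FT.
move=> n; have [mFn Fnoo] := mF n; split.
  by rewrite -[X in measurable X]setTI; exact: mg.
rewrite /pushforward -comp_preimage (_ : g \o f = id) ?preimage_id//.
by apply/funext => x /=; rewrite fK.
Qed.

Lemma sigma_finite_product_measure1 d1 d2 (T1 : measurableType d1)
    (T2 : measurableType d2) (R : realType)
    (m1 : {sigma_finite_measure set T1 -> \bar R})
    (m2 : {sigma_finite_measure set T2 -> \bar R}) :
  sigma_finite setT (m1 \x m2)%E.
Proof.
have /sigma_finiteP[F [TF ndF Foo]] := sigma_finiteT m1.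
have /sigma_finiteP[G [TG ndG Goo]] := sigma_finiteT m2.
exists (fun n => F n `*` G n).
  rewrite -setXTT TF TG predeqE => -[x y]; split.
    move=> [/= [n _ Fnx] [k _ Gky]]; exists (maxn n k) => //; split.
    - by move: x Fnx; exact/subsetPset/ndF/leq_maxl.
    - by move: y Gky; exact/subsetPset/ndG/leq_maxr.
  by move=> [n _ []/= ? ?]; split; exists n.
move=> k; have [? ?] := Foo k; have [? ?] := Goo k.
split; first exact: measurableX.
by rewrite product_measure1E// lte_mul_pinfty// ge0_fin_numE.
Qed.

Section tuple_measure.
Context d (T : measurableType d) (R : realType).

Definition cons_pair (n : nat) (p : T * n.-tuple T) : n.+1.-tuple T :=
  [tuple of p.1 :: p.2].

Lemma measurable_cons_pair (n : nat) : measurable_fun setT (@cons_pair n).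
Proof. exact: measurable_cons. Qed.

Section cons_measure.
Variables (n : nat) (m1 : {sigma_finite_measure set T -> \bar R}).
Variable m2 : {sigma_finite_measure set (n.-tuple T) -> \bar R}.

Definition cons_measure : set (n.+1.-tuple T) -> \bar R :=
  pushforward (m1 \x m2)%E (@cons_pair n).

Let push : {measure set (n.+1.-tuple T) -> \bar R} :=
  measure_function_pushforward__canonical__measure_function_Measure
    (m1 \x m2)%E (@measurable_cons_pair n).

HB.instance Definition _ := isMeasure.Build _ _ _ cons_measure
  (measure0 push) (measure_ge0 push) (@measure_semi_sigma_additive _ _ _ push).

Let uncons (s : n.+1.-tuple T) : T * n.-tuple T :=
  (thead s, [tuple of behead s]).

Let sigma_finite_cons_measure : sigma_finite setT cons_measure.
Proof.
apply: (@sigma_finite_pushforward _ _ _ _ _ (m1 \x m2)%E _ uncons).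
- by apply/measurable_fun_pair; [exact: measurable_tnth|exact: measurable_behead].
- by move=> [x s]; rewrite /uncons/= theadE; congr pair; apply/val_inj.
- exact: sigma_finite_product_measure1.
Qed.

HB.instance Definition _ := Measure_isSigmaFinite.Build _ _ _ cons_measure
  sigma_finite_cons_measure.

End cons_measure.

Fixpoint tuple_measure (n : nat) :
    ('I_n -> {sigma_finite_measure set T -> \bar R}) ->
    {sigma_finite_measure set (n.-tuple T) -> \bar R} :=
  match n with
  | 0%N => fun=> dirac [tuple]
  | n'.+1 => fun m =>
      cons_measure (m ord0) (tuple_measure (fun i : 'I_n' => m (lift ord0 i)))
  end.

End tuple_measure.

Section lebesgue_rV.
Variables (R : realType) (d : nat).

Definition row_of_tuple (s : d.-tuple R) : 'rV[R]_d := \row_i tnth s i.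

Lemma measurable_row_of_tuple :
  @measurable_fun _ _ (d.-tuple (measurableTypeR R)) _ setT row_of_tuple.
Proof.
apply: measurable_fun_mx => i j; under eq_fun do rewrite mxE.
exact: measurable_tnth.
Qed.

Definition lebesgue_rV : set 'rV[R]_d -> \bar R :=
  pushforward
    (tuple_measure (fun _ : 'I_d => @lebesgue_measure R)) row_of_tuple.

Let push : {measure set 'rV[R]_d -> \bar R} :=
  measure_function_pushforward__canonical__measure_function_Measure
    (tuple_measure (fun _ : 'I_d => @lebesgue_measure R))
    measurable_row_of_tuple.

HB.instance Definition _ := isMeasure.Build _ _ _ lebesgue_rV
  (measure0 push) (measure_ge0 push) (@measure_semi_sigma_additive _ _ _ push).

Let tuple_of_row (x : 'rV[R]_d) : d.-tuple (measurableTypeR R) :=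
  [tuple x 0 i | i < d].

Let sigma_finite_lebesgue_rV : sigma_finite setT lebesgue_rV.
Proof.
apply: (@sigma_finite_pushforward _ _ _ _ _
  (tuple_measure (fun _ : 'I_d => @lebesgue_measure R)) _ tuple_of_row).
- apply/measurable_fun_tnthP => i /=.
  rewrite (_ : _ \o _ = (fun x : 'rV[R]_d => x 0 i)).
    exact: measurable_mx_coord.
  by apply/funext => x /=; rewrite tnth_mktuple.
- by move=> s; apply: eq_from_tnth => i; rewrite tnth_mktuple mxE.
- exact: sigma_finiteT.
Qed.

HB.instance Definition _ := Measure_isSigmaFinite.Build _ _ _ lebesgue_rV
  sigma_finite_lebesgue_rV.

End lebesgue_rV.

Section heat.
Variables (R : realType) (d : nat).
Local Notation E := 'rV[R]_d.

(* Kernel of exp(t Delta), not of exp(t Delta / 2). *)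
Definition heat_kernel (t : R) (z : E) : R :=
  (4 * pi * t) `^ (- (d%:R / 2)) * expR (- (\sum_i z 0 i ^+ 2) / (4 * t)).

Definition heat (t : R) (f : E -> R) (x : E) : R :=
  if 0 < t then \int[@lebesgue_rV R d]_y (heat_kernel t (x - y) * f y)
  else f x.

(* The transition probabilities of the semigroup [heat]. *)
Definition heat_measure (t : R) (x : E) (A : set E) : \bar R :=
  if 0 < t then (\int[@lebesgue_rV R d]_(y in A) (heat_kernel t (x - y))%:E)%E
  else dirac x A.

Lemma heat_kernel_ge0 t z : 0 <= heat_kernel t z.
Proof. by rewrite mulr_ge0 ?powR_ge0 ?expR_ge0. Qed.

Lemma measurable_heat_kernel t x :
  measurable_fun [set: E] (fun y => heat_kernel t (x - y)).
Proof.
apply: measurable_funM => //; apply: measurableT_comp => //.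
apply: measurable_funM => //; apply: measurableT_comp => //.
apply: measurable_sum => i; apply: measurable_funX.
under eq_fun do rewrite !mxE.
by apply: measurable_funB => //; exact: measurable_mx_coord.
Qed.

Lemma heat_kernel_le t z : 0 < t ->
  heat_kernel t z <= (4 * pi * t) `^ (- (d%:R / 2)).
Proof.
move=> t0; rewrite /heat_kernel ler_piMr ?powR_ge0// -expR0 ler_expR.
rewrite mulNr oppr_le0 divr_ge0 ?sumr_ge0// ?mulr_ge0 ?ltW// => i _.
exact: sqr_ge0.
Qed.

Section heat_measure.
Variables (t : R) (x : E).

Let heat_measure0 : heat_measure t x set0 = 0%E.
Proof. by rewrite /heat_measure; case: ifP; rewrite ?integral_set0 ?measure0. Qed.

Let heat_measure_ge0 A : (0 <= heat_measure t x A)%E.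
Proof.
rewrite /heat_measure; case: ifP => // _; apply: integral_ge0 => y _.
by rewrite lee_fin heat_kernel_ge0.
Qed.

Let heat_measure_sigma_additive : semi_sigma_additive (heat_measure t x).
Proof.
rewrite /heat_measure; have [t0|t0] := boolP (0 < t); last first.
  exact: measure_semi_sigma_additive.
move=> /= A mA tA mUA; rewrite ge0_integral_bigcup//.
- apply: is_cvg_ereal_nneg_natsum_cond => n _ _.
  by apply: integral_ge0 => y _; rewrite lee_fin heat_kernel_ge0.
- apply: measurable_funTS; apply/measurable_EFinP.
  exact: measurable_heat_kernel.
- by move=> y _; rewrite lee_fin heat_kernel_ge0.
Qed.

HB.instance Definition _ := isMeasure.Build _ _ _ (heat_measure t x)
  heat_measure0 heat_measure_ge0 heat_measure_sigma_additive.

Let sigma_finite_heat_measure : sigma_finite setT (heat_measure t x).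
Proof.
have [t0|t0] := boolP (0 < t); last first.
  rewrite /heat_measure (negPf t0).
  exact: (sigma_finiteT (dirac x : {sigma_finite_measure set E -> \bar R})).
have [F FT mF] := sigma_finiteT (@lebesgue_rV R d).
exists F => // n; have [mFn Fnoo] := mF n; split=> //.
rewrite /heat_measure t0.
pose c := (4 * pi * t) `^ (- (d%:R / 2)).
apply: (@le_lt_trans _ _ (\int[@lebesgue_rV R d]_(y in F n) c%:E)%E).
  apply: ge0_le_integral => //.
  - by move=> y _; rewrite lee_fin heat_kernel_ge0.
  - apply: measurable_funTS; apply/measurable_EFinP.
    exact: measurable_heat_kernel.
  - by move=> y _; rewrite lee_fin heat_kernel_le.
rewrite integral_cst//= lte_mul_pinfty// lee_fin.
exact: powR_ge0.
Qed.

HB.instance Definition _ := Measure_isSigmaFinite.Build _ _ _ (heat_measure t x)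
  sigma_finite_heat_measure.

End heat_measure.
End heat.

Section brownian.
Variables (R : realType) (d : nat).

(* The particles of mu move independently: image under E^k -> E^(k) of the
   product of the heat transition probabilities. The order in which enum_mset
   lists the particles is immaterial. *)
Definition brownian (t : R) (mu : config R d) : set (config R d) -> \bar R :=
  pushforward
    (tuple_measure (fun i : 'I_(size (enum_mset mu)) =>
       heat_measure t (tnth (in_tuple (enum_mset mu)) i)))
    (@config_of_tuple R d (size (enum_mset mu))).

Section brownian_measure.
Variables (t : R) (mu : config R d).

Let push : {measure set (config R d) -> \bar R} :=
  measure_function_pushforward__canonical__measure_function_Measure
    (tuple_measure (fun i : 'I_(size (enum_mset mu)) =>
       heat_measure t (tnth (in_tuple (enum_mset mu)) i)))
    (@measurable_config_of_tuple R d (size (enum_mset mu))).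

HB.instance Definition _ := isMeasure.Build _ _ _ (brownian t mu)
  (measure0 push) (measure_ge0 push) (@measure_semi_sigma_additive _ _ _ push).

End brownian_measure.
End brownian.

Section branching.
Variables (R : realType) (d : nat) (q : nat -> R).
Local Notation E := 'rV[R]_d.
Local Notation Ehat := (config R d).

(* Only the q k with k >= 1 matter. *)
Definition offspring_law : Prop :=
  [/\ forall k, (1 <= k)%N -> 0 <= q k,
      (\sum_(1 <= k <oo) (q k)%:E = 1)%E &
      (1 < \sum_(1 <= k <oo) (k%:R * q k)%:E < +oo)%E].

Definition reaction (u : R) : R :=
  - u + limn (fun n => \sum_(1 <= k < n) q k * u ^+ k).

(* u : [0, +oo[ x R^d -> [0, 1] solves
   u(t) = P_t phi + \int_0^t P_{t-s} (reaction (u(s))) ds;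
   the values of u at negative times are irrelevant. *)
Definition mild_solution (phi : E -> R) (u : R -> E -> R) : Prop :=
  [/\ measurable_fun [set tx : measurableTypeR R * E | 0 <= tx.1 :> R]
        (fun tx => u tx.1 tx.2),
      forall t x, 0 <= t -> 0 <= u t x <= 1 &
      forall t x, 0 <= t ->
        u t x = heat t phi x +
          \int[@lebesgue_measure R]_(s in `[0, t])
            heat (t - s) (fun y => reaction (u s y)) x].

Definition transition_function (H : R -> R.-pker Ehat ~> Ehat) : Prop :=
  (forall mu A, measurable A -> H 0 mu A = dirac mu A) /\
  (forall s t mu A, 0 <= s -> 0 <= t -> measurable A ->
    H (s + t) mu A = (\int[H s mu]_nu H t nu A)%E).

(* The law of the sum of independent copies is the image of the product law. *)
Definition branching_property (H : R -> R.-pker Ehat ~> Ehat) : Prop :=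
  forall t mu1 mu2 A, 0 <= t -> measurable A ->
    H t (config_add mu1 mu2) A =
    (H t mu1 \x H t mu2)%E [set nu | A (config_add nu.1 nu.2)].

Definition branching_transition (H : R -> R.-pker Ehat ~> Ehat) : Prop :=
  [/\ transition_function H, branching_property H &
      forall phi : E -> R, measurable_fun [set: E] phi ->
        (forall x, 0 <= phi x <= 1) ->
        exists2 u, mild_solution phi u &
          forall t mu, 0 <= t -> \int[H t mu]_nu hat phi nu = hat (u t) mu].

End branching.

(* Main.v *)
Require Import Defs.
From mathcomp Require Import all_boot all_order all_algebra.
From mathcomp Require Import finmap multiset.
From mathcomp Require Import all_classical all_reals all_analysis measurable_realfun.
From mathcomp Require Import ring lra.

Set Implicit Arguments.
Unset Strict Implicit.
Unset Printing Implicit Defensive.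

Import Order.TTheory GRing.Theory Num.Theory.
Import numFieldNormedType.Exports.

Local Open Scope classical_set_scope.
Local Open Scope ring_scope.

(** Why the theorem holds. Write [lam] for [1 - q 1], which is positive because
    the mean number of children exceeds [1]. The branching semigroup enters only
    through the mild solution [u] with initial datum [phi], of which the
    left-hand side is a product over the particles; similarly, the integral
    against the law of the Brownian motion is the product of the values of
    [heat t phi] ([integral_brownian]). With two particles or more, both products
    are of smaller order than [t^(-d/2)], so everything rests on the case of one
    particle ([mild_asymptotics]): there is [C > 0] such that
    [t^(d/2) * (expR (lam * t) * u t x - C * heat t phi x)] tends to [0]
    uniformly in [x].

    The reaction is [- lam * u] up to a quadratic error ([reaction_bounds]). Fix
    a final time [t] and a point [x]. By the semigroup law and Tonelli's theorem
    the mild equation becomes an equation for the function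
    [w r = heat (t - r) (u r) x] of the single variable [r], with
    [w 0 = heat t phi x] and [w t = u t x]: its decrement between two times is
    the integral of a sink that lies between [lam * (1 - M) * w] and [lam * w],
    where [M] bounds [u] from the earlier time on ([backward_decr_le],
    [backward_decr_ge]). Three facts follow. As [u] is at most [heat t phi], which
    tends to [0] uniformly, [M] is eventually at most one half, and [u] decays
    exponentially ([mild_exponential_decay]). The function [expR (lam * r) * w r]
    is nondecreasing ([backward_growth]). Finally its growth after a late time
    [S] is a small multiple of [heat t phi x], since the quadratic error is now
    integrable in time ([backward_growth_late]).

    Put [v r = expR (lam * r) * u r]. The last two facts say that [v t] is
    [heat (t - S) (v S)] up to a small multiple of [heat t phi], uniformly in
    [t >= S]. Integrating in space, the mass of [v S] is nondecreasing in [S] and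
    converges; [C] is the limit divided by the mass of [phi]. At large times the
    heat flow of an integrable function is its mass times the heat kernel, up to
    an error [o(t^(-d/2))] uniform in space ([heat_asymptotics]). Applied to
    [v S] and to [heat S phi], both evolved during the time [t - S], this gives
    the claim. *)

(** * Integration of products *)

Section tuple_integral.
Context d (T : measurableType d) (R : realType).

Lemma measurable_tuple_prod n (f : 'I_n -> T -> R) :
  (forall i, measurable_fun setT (f i)) ->
  measurable_fun setT (fun s : n.-tuple T => \prod_i f i (tnth s i)).
Proof.
move=> mf; apply: measurable_prod => i _.
by apply: measurableT_comp => //; exact: measurable_tnth.
Qed.

(** Integrals of products over a product measure factor. The values [a i] are
    assumed finite so that the products are taken in [R]. *)
Lemma integral_tuple_measure n
    (m : 'I_n -> {sigma_finite_measure set T -> \bar R})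
    (f : 'I_n -> T -> R) (a : 'I_n -> R) :
  (forall i, measurable_fun setT (f i)) -> (forall i x, 0 <= f i x) ->
  (forall i, \int[m i]_x (f i x)%:E = (a i)%:E)%E ->
  (\int[tuple_measure m]_s (\prod_i f i (tnth s i))%:E = (\prod_i a i)%:E)%E.
Proof.
elim: n m f a => [|n IH] m f a mf f0 fa.
  under eq_integral do rewrite big_ord0.
  by rewrite /= integral_dirac// diracT mul1e big_ord0.
have mF := measurable_tuple_prod mf.
rewrite [LHS]ge0_integral_pushforward//=; first last.
- by move=> s _; rewrite lee_fin prodr_ge0.
- exact/measurable_EFinP.
- exact: measurable_cons_pair.
rewrite preimage_setT fubini_tonelli1; first last.
- by move=> p; rewrite lee_fin prodr_ge0.
- apply/measurable_EFinP; apply: (measurableT_comp mF).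
  exact: measurable_cons_pair.
have inner x : (\int[tuple_measure (fun i : 'I_n => m (lift ord0 i))]_s
   (\prod_i f i (tnth (cons_pair (x, s)) i))%:E =
   (\prod_(i < n) a (lift ord0 i))%:E * (f ord0 x)%:E)%E.
  under eq_integral => s _.
    rewrite big_ord_recl EFinM tnth0/=.
    under eq_bigr do rewrite tnthS.
    over.
  rewrite ge0_integralZl//; first last.
  - by rewrite lee_fin.
  - by move=> s _; rewrite lee_fin prodr_ge0.
  - apply/measurable_EFinP.
    by apply: (@measurable_tuple_prod _ (fun i => f (lift ord0 i))).
  by rewrite (IH _ (fun i => f (lift ord0 i)) (fun i => a (lift ord0 i)))// muleC.
rewrite /fubini_F.
under eq_integral do rewrite inner.
rewrite ge0_integralZl//; first last.
- rewrite lee_fin prodr_ge0// => i _; rewrite -lee_fin -fa.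
  by apply: integral_ge0 => x _; rewrite lee_fin.
- by move=> x _; rewrite lee_fin.
- exact/measurable_EFinP.
by rewrite fa -EFinM [in RHS]big_ord_recl mulrC.
Qed.

End tuple_integral.

(** * The heat kernel *)

Section heat_kernel_theory.
Variables (R : realType) (d : nat).
Local Notation E := 'rV[R]_d.
Local Notation leb := (@lebesgue_rV R d).
Local Notation ker := (@heat_kernel R d).

Lemma integral_lebesgue_rV_prod (f : 'I_d -> R -> R) (a : 'I_d -> R) :
  (forall i, measurable_fun setT (f i : measurableTypeR R -> R)) ->
  (forall i x, 0 <= f i x) ->
  (forall i, \int[@lebesgue_measure R]_x (f i x)%:E = (a i)%:E)%E ->
  (\int[leb]_y (\prod_i f i (y 0 i))%:E = (\prod_i a i)%:E)%E.
Proof.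
move=> mf f0 fa.
rewrite [LHS]ge0_integral_pushforward//=; first last.
- by move=> s _; rewrite lee_fin prodr_ge0.
- apply/measurable_EFinP; apply: measurable_prod => i _.
  apply: (measurableT_comp (mf i)).
  exact: (measurable_mx_coord (0 : 'I_1) i).
- exact: measurable_row_of_tuple.
rewrite preimage_setT -(integral_tuple_measure mf f0 fa).
apply: eq_integral => s _ /=; congr EFin; apply: eq_bigr => i _.
by rewrite mxE.
Qed.

(** The [d]-dimensional heat kernel is a product of one-dimensional normal
    densities of variance [2 t], so that its integral is [1]. *)
Lemma heat_kernel_normal_pdf (t : R) (x y : E) : 0 < t ->
  ker t (x - y) = \prod_i normal_pdf (x 0 i) (Num.sqrt (2 * t)) (y 0 i).
Proof.
move=> t0; have t20 : 0 < 2 * t by rewrite mulr_gt0.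
have s0 : Num.sqrt (2 * t) != 0 by rewrite gt_eqF// sqrtr_gt0.
under eq_bigr do rewrite normal_pdfE//.
rewrite big_split/= prodr_const card_ord -expR_sum /heat_kernel.
rewrite -sumrN mulr_suml.
congr (_ * expR _); last first.
  apply: eq_bigr => i _; rewrite sqr_sqrtr ?ltW// !mxE -mulr_natr.
  by field; rewrite gt_eqF//.
rewrite /normal_peak sqr_sqrtr ?ltW// powRN.
rewrite exprVn; congr (_^-1).
have h0 : 0 <= 4 * pi * t :> R by rewrite !mulr_ge0 ?pi_ge0// ltW.
rewrite (mulrC d%:R) powRrM powR12_sqrt// powR_mulrn ?sqrtr_ge0//.
by congr (Num.sqrt _ ^+ _); rewrite -mulr_natr; ring.
Qed.

Lemma integral_heat_kernel (t : R) (x : E) : 0 < t ->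
  (\int[leb]_y (ker t (x - y))%:E = 1)%E.
Proof.
move=> t0; under eq_integral do rewrite heat_kernel_normal_pdf//.
rewrite (@integral_lebesgue_rV_prod
  (fun i => normal_pdf (x 0 i) (Num.sqrt (2 * t))) (fun=> 1)).
- by rewrite big1.
- by move=> i; exact: measurable_normal_pdf.
- by move=> i y; exact: normal_pdf_ge0.
- by move=> i; exact: integral_normal_pdf.
Qed.

Lemma heat_kernelC (t : R) (x y : E) : ker t (x - y) = ker t (y - x).
Proof.
rewrite /heat_kernel; under eq_bigr do rewrite !mxE -sqrrN opprB.
by under [in RHS]eq_bigr do rewrite !mxE.
Qed.

(** Completing the square: in the product of two heat kernels the intermediate
    point [y] only occurs in a third heat kernel, centred at the point of the
    segment from [z] to [x] where a Brownian bridge is expected to be. *)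
Lemma heat_kernel_mul (s t : R) (x y z : E) : 0 < s -> 0 < t ->
  ker t (x - y) * ker s (y - z) =
  ker (t + s) (x - z) *
    ker (t * s / (t + s)) ((t + s)^-1 *: (s *: x + t *: z) - y).
Proof.
move=> s0 t0; rewrite /heat_kernel.
have p0 : 0 < 4 * pi :> R by rewrite mulr_gt0// pi_gt0.
have ts0 : 0 < t + s by rewrite addr_gt0.
have q0 (r : R) : 0 < r -> 0 <= 4 * pi * r by move=> r0; apply: mulr_ge0; exact: ltW.
rewrite !(mulrACA _ (expR _)) -!expRD -!powRM; first last.
- exact: q0.
- exact: q0.
- by apply: q0; rewrite divr_gt0 ?mulr_gt0.
- exact: q0.
congr (_ `^ _ * expR _).
  by field; rewrite gt_eqF//.
rewrite -!sumrN !mulr_suml -!big_split/=; apply: eq_bigr => i _.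
by rewrite !mxE; field; rewrite !gt_eqF// mulr_gt0.
Qed.

(** The test on the sign of the time allows a time that varies with the
    parameter, without any restriction on its range. *)
Lemma measurable_heat_kernel_comp d' (T : measurableType d')
    (a : T -> R) (b : T -> E) :
  measurable_fun setT a -> measurable_fun setT b ->
  measurable_fun setT (fun p => if 0 < a p then ker (a p) (b p) else 0).
Proof.
move=> ma mb.
(* The inverse of the time is written as a power, a measurable function. *)
rewrite (_ : (fun p => _) = (fun p => if 0 < a p then
   (4 * pi * a p) `^ (- (d%:R / 2)) *
     expR (- (\sum_i b p 0 i ^+ 2) * (4 * a p) `^ (-1)) else 0)); last first.
  apply/funext => p; case: ifPn => // a0.
  by rewrite powR_inv1// mulr_ge0// ltW.
apply: measurable_fun_ifT => //.
  by apply: measurable_fun_ltr.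
apply: measurable_funM.
  apply: (measurableT_comp (measurable_powR _)).
  exact: measurable_funM.
apply: measurableT_comp => //; apply: measurable_funM.
  apply: measurableT_comp => //; apply: measurable_sum => i.
  apply: measurable_funX.
  apply: (measurableT_comp (measurable_mx_coord (0 : 'I_1) i)) => //.
apply: (measurableT_comp (measurable_powR _)).
exact: measurable_funM.
Qed.

Lemma measurable_mx_sub d' (T : measurableType d') (a b : T -> E) :
  measurable_fun setT a -> measurable_fun setT b ->
  measurable_fun setT (fun p => a p - b p).
Proof.
move=> ma mb; apply: measurable_fun_mx => i j.
under eq_fun do rewrite !mxE.
by apply: measurable_funB;
  apply: (measurableT_comp (measurable_mx_coord i j)).
Qed.

End heat_kernel_theory.

(** * The heat semigroup on nonnegative functions *)

Section eheat.
Variables (R : realType) (d : nat).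
Local Notation E := 'rV[R]_d.
Local Notation leb := (@lebesgue_rV R d).
Local Notation ker := (@heat_kernel R d).
Implicit Types (t s : R) (f g : E -> \bar R) (x y z : E).
Local Open Scope ereal_scope.

(** The heat semigroup on functions with values in [[0, +oo]]: there Tonelli's
    theorem and monotonicity hold with no integrability assumption. *)
Definition eheat t f x : \bar R :=
  if (0 < t)%R then \int[leb]_y ((ker t (x - y))%:E * f y) else f x.

Lemma eheat0 f x : eheat 0 f x = f x.
Proof. by rewrite /eheat ltxx. Qed.

Lemma measurable_heat_integrand t f x : measurable_fun setT f ->
  measurable_fun setT (fun y => (ker t (x - y))%:E * f y).
Proof.
move=> mf; apply: emeasurable_funM => //; apply/measurable_EFinP.
exact: measurable_heat_kernel.
Qed.

Lemma heat_integrand_ge0 t f x y : (forall y, 0 <= f y) ->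
  0 <= (ker t (x - y))%:E * f y.
Proof. by move=> f0; rewrite mule_ge0// lee_fin heat_kernel_ge0. Qed.

Lemma eheat_ge0 t f x : (forall y, 0 <= f y) -> 0 <= eheat t f x.
Proof.
move=> f0; rewrite /eheat; case: ifP => // _; apply: integral_ge0 => y _.
exact: heat_integrand_ge0.
Qed.

Lemma eq_eheat t f g : f =1 g -> eheat t f =1 eheat t g.
Proof. by move=> /funext ->. Qed.

Lemma le_eheat t f g x : measurable_fun setT f -> measurable_fun setT g ->
  (forall y, 0 <= f y) -> (forall y, f y <= g y) -> eheat t f x <= eheat t g x.
Proof.
move=> mf mg f0 fg; rewrite /eheat; case: ifP => // _.
apply: ge0_le_integral => //.
- by move=> y _; exact: heat_integrand_ge0.
- exact: measurable_heat_integrand.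
- exact: measurable_heat_integrand.
- by move=> y _; rewrite lee_wpmul2l// lee_fin heat_kernel_ge0.
Qed.

Lemma eheatD t f g x : measurable_fun setT f -> measurable_fun setT g ->
  (forall y, 0 <= f y) -> (forall y, 0 <= g y) ->
  eheat t (f \+ g) x = eheat t f x + eheat t g x.
Proof.
move=> mf mg f0 g0; rewrite /eheat; case: ifP => // _.
rewrite -ge0_integralD//.
- by apply: eq_integral => y _ /=; rewrite ge0_muleDr.
- by move=> y _; exact: heat_integrand_ge0.
- exact: measurable_heat_integrand.
- by move=> y _; exact: heat_integrand_ge0.
- exact: measurable_heat_integrand.
Qed.

Lemma eheatZ t (k : R) f x : (0 <= k)%R -> measurable_fun setT f ->
  (forall y, 0 <= f y) -> eheat t (fun y => k%:E * f y) x = k%:E * eheat t f x.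
Proof.
move=> k0 mf f0; rewrite /eheat; case: ifP => // _.
rewrite -ge0_integralZl//.
- by apply: eq_integral => y _ /=; rewrite muleCA.
- exact: measurable_heat_integrand.
- by move=> y _; exact: heat_integrand_ge0.
Qed.

Lemma eheat_cst t (k : R) x : (0 <= k)%R -> eheat t (cst k%:E) x = k%:E.
Proof.
move=> k0; rewrite /eheat; case: ifP => // t0; rewrite /=.
rewrite ge0_integralZr//.
- by rewrite integral_heat_kernel// mul1e.
- by apply/measurable_EFinP; exact: measurable_heat_kernel.
- by move=> y _; rewrite lee_fin heat_kernel_ge0.
Qed.

Lemma eheat_le_cst t f (k : R) x : (0 <= k)%R -> measurable_fun setT f ->
  (forall y, 0 <= f y) -> (forall y, f y <= k%:E) -> eheat t f x <= k%:E.
Proof.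
move=> k0 mf f0 fk; rewrite -[leRHS](@eheat_cst t k x)//.
by apply: le_eheat => //; exact: measurable_cst.
Qed.

(** The smoothing estimate holds because the heat kernel at time [t] nowhere
    exceeds its value [(4 pi t)^(-d/2)] at the origin. *)
Lemma eheat_le_mass t f x : (0 < t)%R -> measurable_fun setT f ->
  (forall y, 0 <= f y) ->
  eheat t f x <= ((4 * pi * t) `^ (- (d%:R / 2)))%:E * \int[leb]_y f y.
Proof.
move=> t0 mf f0; rewrite /eheat t0 -ge0_integralZl//; last first.
  by rewrite lee_fin powR_ge0.
apply: ge0_le_integral => //.
- by move=> y _; exact: heat_integrand_ge0.
- exact: measurable_heat_integrand.
- exact: measurable_funeM.
- by move=> y _; rewrite lee_wpmul2r// lee_fin heat_kernel_le.
Qed.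

Lemma measurable_eheat_comp d' (T : measurableType d') (a : T -> R)
    (b : T -> E) (f : T -> E -> \bar R) :
  measurable_fun setT a -> measurable_fun setT b ->
  measurable_fun setT (fun p : T * E => f p.1 p.2) -> (forall p y, 0 <= f p y) ->
  measurable_fun setT (fun p => eheat (a p) (f p) (b p)).
Proof.
move=> ma mb mf f0.
rewrite (_ : (fun p => _) = (fun p => if (0 < a p)%R then
  fubini_F leb (fun p : T * E =>
    (if (0 < a p.1)%R then ker (a p.1) (b p.1 - p.2) else 0%R)%:E *
    f p.1 p.2) p else f p (b p))); last first.
  apply/funext => p; rewrite /eheat /fubini_F/=.
  by case: ifPn => // a0; apply: eq_integral => y _; rewrite a0.
apply: measurable_fun_ifT.
- exact: measurable_fun_ltr.
- apply: measurable_fun_fubini_tonelli_F.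
    apply: emeasurable_funM => //; apply/measurable_EFinP.
    apply: (@measurable_heat_kernel_comp _ _ _ _ (a \o fst)
              (fun p : T * E => b p.1 - p.2)%R).
      exact: measurableT_comp.
    by apply: measurable_mx_sub => //; exact: measurableT_comp.
  move=> p; rewrite mule_ge0//; case: ifP => // _.
  by rewrite lee_fin heat_kernel_ge0.
- exact: (@measurableT_comp _ _ _ _ _ _ _ _ (fun p => (p, b p)) mf
    (measurable_fun_pair (@measurable_id _ _ _) mb)).
Qed.

Lemma measurable_eheat t f : measurable_fun setT f -> (forall y, 0 <= f y) ->
  measurable_fun setT (eheat t f).
Proof.
move=> mf f0; apply: (@measurable_eheat_comp _ E (fun=> t) id (fun=> f)) => //.
exact: measurableT_comp.
Qed.

(** Tonelli's theorem for the nonnegative heat kernel. *)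
Lemma eheat_integral d' (T : measurableType d')
    (m : {sigma_finite_measure set T -> \bar R}) (g : T -> E -> \bar R) t x :
  measurable_fun setT (fun p : T * E => g p.1 p.2) -> (forall p y, 0 <= g p y) ->
  eheat t (fun y => \int[m]_s g s y) x = \int[m]_s eheat t (g s) x.
Proof.
move=> mg g0; rewrite /eheat; case: ifP => // t0.
rewrite (@fubini_tonelli _ _ _ _ _ m leb
  (fun p => (ker t (x - p.2))%:E * g p.1 p.2)) /=.
- apply: eq_integral => y _; rewrite ge0_integralZl//.
  + exact: measurable_fun_pair1 mg.
  + by rewrite lee_fin heat_kernel_ge0.
- apply: emeasurable_funM => //; apply/measurable_EFinP => /=.
  by apply: (measurableT_comp (measurable_heat_kernel t x)).
- by move=> p; exact: heat_integrand_ge0.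
Qed.

(** The semigroup law. By [heat_kernel_mul] the kernel [K_t(x - y) K_s(y - z)]
    is, as a function of [y], the constant [K_(t+s)(x - z)] times a heat kernel,
    which has integral one. *)
Lemma eheat_eheat s t f x : (0 <= s)%R -> (0 <= t)%R ->
  measurable_fun setT f -> (forall y, 0 <= f y) ->
  eheat t (eheat s f) x = eheat (t + s) f x.
Proof.
rewrite le_eqVlt => /predU1P[<-|s0].
  by rewrite addr0 => _ _ _; apply: eq_eheat => y; exact: eheat0.
rewrite le_eqVlt => /predU1P[<-|t0] mf f0; first by rewrite add0r eheat0.
have ts0 : (0 < t + s)%R by rewrite addr_gt0.
transitivity (eheat t (fun y => \int[leb]_z ((ker s (y - z))%:E * f z)) x).
  by apply: eq_eheat => y; rewrite /eheat s0.
rewrite (@eheat_integral _ _ _ (fun z y => (ker s (y - z))%:E * f z)); first last.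
- by move=> z y; exact: heat_integrand_ge0.
- apply: emeasurable_funM; last exact: measurableT_comp.
  apply/measurable_EFinP.
  apply: (eq_measurable_fun (fun p : E * E =>
     if (0 < s)%R then ker s (p.2 - p.1) else 0%R)); first by rewrite s0.
  apply: (@measurable_heat_kernel_comp _ _ _ _ (fun=> s)) => //.
  exact: measurable_mx_sub.
rewrite [RHS]/eheat ts0; apply: eq_integral => z _.
rewrite /eheat t0.
under eq_integral => y _ do
  rewrite muleA -EFinM heat_kernel_mul// EFinM -muleA (muleC _ (f z)) muleA.
rewrite ge0_integralZl//.
- rewrite integral_heat_kernel ?mule1//.
  by rewrite divr_gt0// mulr_gt0.
- by apply/measurable_EFinP; exact: measurable_heat_kernel.
- by move=> y _; rewrite lee_fin heat_kernel_ge0.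
- exact: heat_integrand_ge0.
Qed.

(** The heat flow preserves the total mass: by Tonelli's theorem, and since the
    kernel is symmetric, the integral in [x] is carried out first. *)
Lemma integral_eheat t f : measurable_fun setT f -> (forall y, 0 <= f y) ->
  \int[leb]_x eheat t f x = \int[leb]_x f x.
Proof.
move=> mf f0; have [t0|t0] := boolP (0 < t)%R; last first.
  by apply: eq_integral => x _; rewrite /eheat (negPf t0).
under eq_integral => x _ do rewrite /eheat t0.
rewrite (@fubini_tonelli _ _ _ _ _ leb leb
  (fun p => (ker t (p.1 - p.2))%:E * f p.2)) /=; first last.
- by move=> p; exact: heat_integrand_ge0.
- apply: emeasurable_funM; last exact: measurableT_comp.
  apply/measurable_EFinP.
  apply: (eq_measurable_fun (fun p : E * E =>
     if (0 < t)%R then ker t (p.1 - p.2) else 0%R)); first by rewrite t0.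
  apply: (@measurable_heat_kernel_comp _ _ _ _ (fun=> t)) => //.
  exact: measurable_mx_sub.
apply: eq_integral => y _.
under eq_integral => x _ do rewrite heat_kernelC muleC.
rewrite ge0_integralZl//.
- by rewrite integral_heat_kernel ?mule1.
- by apply/measurable_EFinP; exact: measurable_heat_kernel.
- by move=> x _; rewrite lee_fin heat_kernel_ge0.
Qed.

(** [heat] is defined by a real-valued integral; since the kernel has integral
    one, nothing is lost when [h] is bounded. *)
Lemma heatE t (h : E -> R) (M : R) x : measurable_fun setT h ->
  (forall y, 0 <= h y <= M)%R -> (heat t h x)%:E = eheat t (EFin \o h) x.
Proof.
move=> mh h0M; have M0 : (0 <= M)%R.
  by have /andP[h0 hM] := h0M x; exact: le_trans hM.
have h0 y : 0 <= (h y)%:E by rewrite lee_fin; case/andP: (h0M y).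
have mEh : measurable_fun setT (EFin \o h) by exact/measurable_EFinP.
have eM : eheat t (EFin \o h) x <= M%:E.
  by apply: eheat_le_cst => //= y; rewrite lee_fin; case/andP: (h0M y).
have e0 : 0 <= eheat t (EFin \o h) x by exact: eheat_ge0.
rewrite -[RHS]fineK; last first.
  by rewrite ge0_fin_numE// (le_lt_trans eM) ?ltry.
by congr EFin; rewrite /heat /eheat; case: ifP.
Qed.

End eheat.

(** * The reaction term *)

Section reaction_theory.
Variables (R : realType) (q : nat -> R).
Hypothesis q_law : offspring_law q.
Implicit Types (v : R) (n : nat).

Let qge0 k : (1 <= k)%N -> 0 <= q k. Proof. by case: q_law => + _ _; exact. Qed.

Let psum v n := \sum_(1 <= k < n) q k * v ^+ k.

Lemma offspring_partial_sum_le1 n : \sum_(1 <= k < n) q k <= 1.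
Proof.
case: q_law => _ q1 _; rewrite -lee_fin -sumEFin -q1.
by apply: (@nneseries_lim_ge _ _ xpredT) => k k1 _; rewrite lee_fin qge0.
Qed.

Lemma offspring_tail_le n : \sum_(2 <= k < n) q k <= 1 - q 1%N.
Proof.
have [n1|n1] := leqP n 1.
  rewrite big_geq ?(leq_trans n1)// subr_ge0.
  by have := offspring_partial_sum_le1 2; rewrite big_nat1.
by rewrite lerBrDl -big_ltn// offspring_partial_sum_le1.
Qed.

(** Were [q 1] equal to [1], every particle would have exactly one child and the
    mean would be [1]. *)
Lemma offspring_q1_lt1 : q 1%N < 1.
Proof.
rewrite ltNge; apply/negP => q1; case: q_law => _ _ /andP[+ _].
apply/negP; rewrite -leNgt.
apply: lime_le.
  by apply: is_cvg_ereal_nneg_natsum_cond => n n1 _; rewrite lee_fin mulr_ge0 ?qge0.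
near=> n; rewrite sumEFin lee_fin.
have q0 k : (2 <= k)%N -> q k = 0.
  move=> k2; apply/eqP; rewrite eq_le qge0 ?(leq_trans _ k2)// andbT.
  have := offspring_tail_le k.+1; rewrite big_nat_recr//= => h.
  have h0 : 0 <= \sum_(2 <= i < k) q i.
    rewrite big_nat_cond sumr_ge0// => i /andP[/andP[i2 _] _].
    by rewrite qge0// (leq_trans _ i2).
  lra.
rewrite big_ltn; last by near: n; exists 2%N.
rewrite big_nat_cond big1 ?addr0 ?mul1r; last first.
  by move=> k /andP[/andP[k2 _] _]; rewrite q0// mulr0.
by have := offspring_partial_sum_le1 2; rewrite big_nat1.
Unshelve. all: by end_near. Qed.

Let psum_le1 v n : 0 <= v <= 1 -> psum v n <= 1.
Proof.
move=> /andP[v0 v1]; apply: le_trans (offspring_partial_sum_le1 n).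
apply: ler_sum_nat => k /andP[k1 _].
by rewrite ler_piMr ?qge0 ?exprn_ile1.
Qed.

Let psum_nd v : 0 <= v -> {homo psum v : n m / (n <= m)%N >-> n <= m}.
Proof.
move=> v0; apply/nondecreasing_seqP => n; rewrite /psum.
have [n0|n0] := posnP n; first by rewrite n0 !big_geq.
by rewrite big_nat_recr//= lerDl mulr_ge0 ?qge0 ?exprn_ge0.
Qed.

Lemma cvg_reaction_series v : 0 <= v <= 1 ->
  cvgn (fun n => \sum_(1 <= k < n) q k * v ^+ k).
Proof.
move=> v01; apply: nondecreasing_is_cvgn; first by apply: psum_nd; case/andP: v01.
by exists 1 => _ [n _ <-]; exact: psum_le1.
Qed.

(** Splitting off the linear term leaves the remainder
    [\sum_(k >= 2) q k * v ^+ k], which is nonnegative and at most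
    [(1 - q 1) * v ^+ 2]: the reaction is [- (1 - q 1) * v] up to a quadratic
    error. *)
Lemma reaction_bounds v : 0 <= v <= 1 ->
  (1 - q 1%N) * (v * (1 - v)) <= - reaction q v <= (1 - q 1%N) * v.
Proof.
move=> v01; have cv := cvg_reaction_series v01; have /andP[v0 v1] := v01.
rewrite /reaction opprD opprK; set L := limn _.
have : q 1%N * v <= L.
  apply: limr_ge => //; near=> n.
  apply: (@le_trans _ _ (psum v 2)); first by rewrite /psum big_nat1 expr1.
  by apply: psum_nd => //; near: n; exists 2%N.
have : L <= q 1%N * v + (1 - q 1%N) * v ^+ 2.
  apply: limr_le => //; near=> n.
  rewrite big_ltn; last by near: n; exists 2%N.
  rewrite expr1 lerD2l.
  apply: (@le_trans _ _ ((\sum_(2 <= k < n) q k) * v ^+ 2)); last first.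
    by rewrite ler_wpM2r ?exprn_ge0 ?offspring_tail_le.
  rewrite mulr_suml; apply: ler_sum_nat => k /andP[k2 _].
  by rewrite ler_wpM2l ?qge0 ?(leq_trans _ k2)// ler_wiXn2l.
by rewrite expr2; nra.
Unshelve. all: by end_near. Qed.

Lemma measurable_reaction d (T : measurableType d) (f : T -> R) :
  measurable_fun setT f -> (forall p, 0 <= f p <= 1) ->
  measurable_fun setT (fun p => reaction q (f p)).
Proof.
move=> mf f01; apply: measurable_funD; first exact: measurableT_comp.
apply: (@measurable_fun_cvg _ _ _ _ (fun n p => psum (f p) n)).
  move=> n; apply: measurable_sum => k.
  by apply: measurable_funM => //; exact: measurable_funX.
by move=> p _; exact: cvg_reaction_series.
Qed.

End reaction_theory.

(** * The mild equation seen from the final time *)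

Section mild_theory.
Variables (R : realType) (d : nat) (q : nat -> R).
Hypothesis q_law : offspring_law q.
Local Notation E := 'rV[R]_d.
Local Notation TR := (measurableTypeR R).
Local Notation leb1 := (@lebesgue_measure R).
Variables (phi : E -> R) (u : R -> E -> R).
Hypotheses (mphi : measurable_fun setT phi) (phi01 : forall x, 0 <= phi x <= 1).
Hypothesis u_mild : mild_solution q phi u.
Local Notation lam := (1 - q 1%N).

Lemma mild_itv01 t x : 0 <= t -> 0 <= u t x <= 1.
Proof. by case: u_mild => _ + _; exact. Qed.

(** Extending [u] by [0] to negative times makes it measurable on the whole
    product space, so that Tonelli applies without restricting the domain. *)
Let ux (s : TR) (y : E) : R := if 0 <= s :> R then u s y else 0.

Let uxE s y : 0 <= s :> R -> ux s y = u s y.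
Proof. by rewrite /ux => ->. Qed.

Let ux01 s y : 0 <= ux s y <= 1.
Proof. by rewrite /ux; case: ifPn => [/mild_itv01//|]; rewrite lexx ler01. Qed.

Let measurable_ux : measurable_fun setT (fun p : TR * E => ux p.1 p.2).
Proof.
apply: measurable_fun_if => //.
  by apply: measurable_fun_ler => //; exact: measurable_fst.
rewrite setTI (_ : _ @^-1` _ = [set tx : TR * E | 0 <= tx.1 :> R]).
  by case: u_mild.
by apply/seteqP; split => p /=; case: leP.
Qed.

Lemma measurable_mild t : 0 <= t -> measurable_fun setT (u t).
Proof.
move=> t0; apply: (eq_measurable_fun (ux t)); first by move=> y _; rewrite /ux t0.
exact: (measurable_fun_pair2 (t : TR) measurable_ux).
Qed.

(** The mass destroyed by the reaction, per unit of time. *)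
Let sink (s : TR) (y : E) : R := - reaction q (ux s y).

Let sink_bounds s y :
  lam * (ux s y * (1 - ux s y)) <= sink s y <= lam * ux s y.
Proof. exact: reaction_bounds. Qed.

Let lam_ge0 : 0 <= lam.
Proof. by rewrite subr_ge0 ltW ?offspring_q1_lt1. Qed.

Let sink01 s y : 0 <= sink s y <= 1.
Proof.
have /andP[s1 s2] := sink_bounds s y; have /andP[u0 u1] := ux01 s y.
have q1 : 0 <= q 1%N by case: q_law => + _ _; exact.
apply/andP; split.
  by apply: le_trans s1; rewrite !mulr_ge0// subr_ge0.
by apply: (le_trans s2); rewrite mulr_ile1// gerBl.
Qed.

Let measurable_sink : measurable_fun setT (fun p : TR * E => (sink p.1 p.2)%:E).
Proof.
apply/measurable_EFinP; apply: measurableT_comp => //.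
exact: measurable_reaction.
Qed.

Let sink_ge0 s y : (0 <= (sink s y)%:E)%E.
Proof. by rewrite lee_fin; case/andP: (sink01 s y). Qed.

Let measurable_sinks s : measurable_fun setT (EFin \o sink s).
Proof. exact: (measurable_fun_pair2 s measurable_sink). Qed.

Let esink t s x := eheat (t - s) (EFin \o sink s) x.

Let esink_ge0 t s x : (0 <= esink t s x)%E.
Proof. by apply: eheat_ge0 => y; exact: sink_ge0. Qed.

Let measurable_esink t : measurable_fun setT (fun p : TR * E => esink t p.1 p.2).
Proof.
apply: (@measurable_eheat_comp _ _ _ (TR * E)%type (fun p => t - p.1) snd
  (fun p => EFin \o sink p.1)) => //; last by move=> p y; exact: sink_ge0.
  by apply: measurable_funB => //; exact: measurable_fst.
apply: (@measurableT_comp _ _ _ _ _ _ (fun p : TR * E => (sink p.1 p.2)%:E) _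
  (fun p : TR * E * E => (p.1.1, p.2))) => //.
by apply: measurable_fun_pair => //; exact: measurableT_comp.
Qed.

Let measurable_esinks t x : measurable_fun setT (fun s : TR => esink t s x).
Proof. exact: (measurable_fun_pair1 x (measurable_esink t)). Qed.

Let esink_le1 t s x : (esink t s x <= 1)%E.
Proof.
apply: eheat_le_cst => //= y.
by rewrite lee_fin; case/andP: (sink01 s y).
Qed.

(** The mild equation as an identity between nonnegative integrals: the sink
    moved to the left-hand side is nonnegative. *)
Lemma mild_eheat t x : 0 <= t ->
  ((u t x)%:E + \int[leb1]_(s in `[0%R, t]) esink t s x =
   eheat t (EFin \o phi) x)%E.
Proof.
move=> t0; case: u_mild => _ _ /(_ t x t0) ->.
rewrite -(heatE t x mphi phi01).
pose I := (\int[leb1]_(s in `[0%R, t]) esink t s x)%E; rewrite -/I.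
have heatN (s : R) : 0 <= s ->
    (heat (t - s) (fun y => reaction q (u s y)) x)%:E = (- esink t s x)%E.
  move=> s0; have E1 : (fun y => reaction q (u s y)) = \- sink s.
    by apply/funext => y; rewrite /= /sink /ux s0 opprK.
  rewrite E1 /esink -(@heatE _ _ _ _ 1)//; last exact/measurable_EFinP.
  rewrite -EFinN; congr EFin; rewrite /heat; case: ifP => // _.
  rewrite /Rintegral -fineN -integral_ge0N//.
    by congr fine; apply: eq_integral => y _; rewrite /= mulrN EFinN.
  by move=> y _; rewrite lee_fin mulr_ge0 ?heat_kernel_ge0//; case/andP: (sink01 s y).
have I0 : (0 <= I)%E by apply: integral_ge0.
have Ioo : (I < +oo)%E.
  apply: (@le_lt_trans _ _ (\int[leb1]_(s in `[0%R, t]) cst 1 s)%E).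
    apply: ge0_le_integral => //.
    by apply: measurable_funTS; exact: measurable_esinks.
  by rewrite integral_cst//= lebesgue_measure_itv/= mul1e; case: ifP; rewrite ?ltry.
rewrite /Rintegral (_ : (\int[_]_(_ in _) _)%E = - I)%E; last first.
  rewrite -integral_ge0N//; apply: eq_integral => s.
  by rewrite inE/= in_itv/= => /andP[s0 _]; exact: heatN.
rewrite fineN -[in X in (_ + X)%E](@fineK _ I) ?ge0_fin_numE//.
by rewrite -EFinD subrK.
Qed.

Lemma mild_le_heat t x : 0 <= t -> u t x <= heat t phi x.
Proof.
move=> t0; rewrite -lee_fin (heatE _ _ mphi phi01) -mild_eheat//.
by rewrite leeDl// integral_ge0.
Qed.

(** The mild equation transported to the terminal time [t]: applying the heat
    semigroup over the remaining time [t - r] to the equation at time [r]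
    turns it, by the semigroup law and Tonelli, into an equation for the
    function [r |-> P_(t-r) u(r)] of one real variable. *)
Let backward_eheat t r x : 0 <= r <= t ->
  (eheat (t - r) (EFin \o u r) x + \int[leb1]_(s in `[0%R, r]) esink t s x =
   eheat t (EFin \o phi) x)%E.
Proof.
move=> /andP[r0 rt].
have phi0 y : (0 <= (EFin \o phi) y)%E by rewrite lee_fin; case/andP: (phi01 y).
have mEphi : measurable_fun setT (EFin \o phi) by exact/measurable_EFinP.
have tr0 : 0 <= t - r by rewrite subr_ge0.
rewrite -[in RHS](subrK r t) -[RHS]eheat_eheat//.
pose D : set TR := `[0%R, r]%classic.
have mD : measurable D by exact: measurable_itv.
pose g (s : TR) y := ((\1_D s)%:E * esink r s y)%E.
have g0 s y : (0 <= g s y)%E by rewrite mule_ge0// lee_fin.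
have mg : measurable_fun setT (fun p : TR * E => g p.1 p.2).
  apply: emeasurable_funM; last exact: measurable_esink.
  apply/measurable_EFinP.
  by apply: (@measurableT_comp _ _ _ _ _ _ (\1_D : TR -> R)).
have Jg y : (\int[leb1]_(s in `[0%R, r]) esink r s y = \int[leb1]_s g s y)%E.
  rewrite integral_mkcond epatch_indic; apply: eq_integral => s _.
  by rewrite /g/= muleC.
rewrite [RHS](@eq_eheat _ _ _ _ (fun y => (u r y)%:E + \int[leb1]_s g s y)%E); last first.
  by move=> y; rewrite -mild_eheat// Jg.
have mu : measurable_fun setT (EFin \o u r).
  by apply/measurable_EFinP; exact: measurable_mild.
have u0 y : (0 <= (EFin \o u r) y)%E.
  by rewrite lee_fin; case/andP: (mild_itv01 y r0).
rewrite (@eheatD _ _ _ (EFin \o u r) (fun y => \int[leb1]_s g s y)%E)//; first last.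
- by move=> y; apply: integral_ge0.
- apply: (@measurable_fun_fubini_tonelli_F _ _ _ _ _ leb1 (fun p : E * TR => g p.2 p.1)).
    apply: (@measurableT_comp _ _ _ _ _ _ (fun p : TR * E => g p.1 p.2) _
      (fun p : E * TR => (p.2, p.1))) => //.
    by apply: measurable_fun_pair; [exact: measurable_snd|exact: measurable_fst].
  by move=> p; exact: g0.
congr (_ + _)%E; rewrite eheat_integral// integral_mkcond epatch_indic.
apply: eq_integral => s _; rewrite /g eheatZ//.
- have [|sr] := boolP (s \in D); last first.
    by rewrite /= indicE (negPf sr) mul0e mule0.
  move=> sr; rewrite /= muleC /esink eheat_eheat//.
    by rewrite addrA subrK.
  by move: sr; rewrite inE /D/= in_itv/= subr_ge0 => /andP[].
- by move=> y; exact: sink_ge0.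
- by apply: measurable_eheat => // y; exact: sink_ge0.
Qed.

(** As [r] goes from [0] to [t], this interpolates between the heat flow of the
    initial datum and the solution, both at time [t] and at the point [x]. *)
Definition backward t r x := heat (t - r) (u r) x.

Let backwardE t r x : 0 <= r ->
  (backward t r x)%:E = eheat (t - r) (EFin \o u r) x.
Proof.
move=> r0; apply: (@heatE _ _ _ _ 1); first exact: measurable_mild.
by move=> y; exact: mild_itv01.
Qed.

Lemma backward_ge0 t r x : 0 <= r -> 0 <= backward t r x.
Proof.
move=> r0; rewrite -lee_fin backwardE//; apply: eheat_ge0 => y.
by rewrite lee_fin; case/andP: (mild_itv01 y r0).
Qed.

Lemma backward0 t x : backward t 0 x = heat t phi x.
Proof.
rewrite /backward subr0; congr (heat t _ x); apply/funext => y.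
apply/EFin_inj; have := @mild_eheat 0 y (lexx _).
by rewrite eheat0 set_itv1 integral_set1 adde0.
Qed.

Lemma backward_diag t x : backward t t x = u t x.
Proof. by rewrite /backward subrr /heat ltxx. Qed.

Let esink_upper t s x : 0 <= s -> (esink t s x <= (lam * backward t s x)%:E)%E.
Proof.
move=> s0; rewrite EFinM backwardE// -eheatZ//; first last.
- by move=> y; rewrite lee_fin; case/andP: (mild_itv01 y s0).
- by apply/measurable_EFinP; exact: measurable_mild.
apply: le_eheat => //.
- apply: measurable_funeM; apply/measurable_EFinP; exact: measurable_mild.
- by move=> y; exact: sink_ge0.
move=> y; rewrite /= lee_fin.
by have /andP[_] := sink_bounds s y; rewrite uxE.
Qed.

Let esink_lower t s x (M : R) : 0 <= s -> M <= 1 -> (forall y, u s y <= M) ->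
  ((lam * (1 - M) * backward t s x)%:E <= esink t s x)%E.
Proof.
move=> s0 M1 uM; rewrite EFinM backwardE// -eheatZ//; first last.
- by move=> y; rewrite lee_fin; case/andP: (mild_itv01 y s0).
- by apply/measurable_EFinP; exact: measurable_mild.
- by rewrite mulr_ge0// subr_ge0.
have cM0 : 0 <= lam * (1 - M) by rewrite mulr_ge0// subr_ge0.
apply: le_eheat => //.
- apply: measurable_funeM; apply/measurable_EFinP; exact: measurable_mild.
- move=> y; rewrite mule_ge0 ?lee_fin//.
  by case/andP: (mild_itv01 y s0).
move=> y; rewrite /= lee_fin.
have /andP[+ _] := sink_bounds s y; rewrite uxE//; apply: le_trans.
rewrite -mulrA ler_wpM2l// mulrC ler_wpM2l ?lerB//.
by case/andP: (mild_itv01 y s0).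
Qed.

Let backwardD t a b x : 0 <= a -> a <= b -> b <= t ->
  ((backward t b x)%:E + \int[leb1]_(s in `]a, b]) esink t s x =
   (backward t a x)%:E)%E.
Proof.
move=> a0 ab bt; have b0 := le_trans a0 ab.
have := @backward_eheat t a x; rewrite a0 (le_trans ab bt) => /(_ isT).
have := @backward_eheat t b x; rewrite b0 bt => /(_ isT) <-.
rewrite -!backwardE// (@itv_bndbnd_setU _ _ (BLeft 0) (BRight a) (BRight b))//.
rewrite ge0_integral_setU//=; first last.
- rewrite disj_set2E; apply/eqP/seteqP; split => // s [/=].
  by rewrite !in_itv/= => /andP[_ sa] /andP[/lt_le_trans/(_ sa)]; rewrite ltxx.
- by apply: measurable_funTS; exact: measurable_esinks.
set A := (\int[leb1]_(s in `[0%R, a]) esink t s x)%E.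
have fA : A \is a fin_num.
  rewrite ge0_fin_numE ?integral_ge0//.
  apply: (@le_lt_trans _ _ (\int[leb1]_(s in `[0%R, a]) cst 1 s)%E).
    apply: ge0_le_integral => //.
    by apply: measurable_funTS; exact: measurable_esinks.
  by rewrite integral_cst//= lebesgue_measure_itv/= mul1e; case: ifP; rewrite ?ltry.
move=> wA; rewrite -[RHS](addeK _ fA) wA -[LHS](addeK _ fA).
by congr (_ - A)%E; rewrite -addeA (addeC A).
Qed.

Lemma backward_noninc t a b x : 0 <= a -> a <= b -> b <= t ->
  backward t b x <= backward t a x.
Proof.
move=> a0 ab bt; rewrite -lee_fin -(@backwardD t a b)// leeDl//.
exact: integral_ge0.
Qed.

Let measure_itvoc a b : a <= b -> leb1 (`]a, b] : set R) = (b - a)%:E.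
Proof.
rewrite lebesgue_measure_itv/= lte_fin le_eqVlt => /predU1P[->|->//].
by rewrite ltxx subrr.
Qed.

(** The decrement is the integral of the sink, at most [1 - q 1] times the function
    [r |-> P_(t-r) u(r)], which is largest at the left end of the interval. *)
Lemma backward_decr_le t a b x : 0 <= a -> a <= b -> b <= t ->
  backward t a x - backward t b x <= lam * (b - a) * backward t a x.
Proof.
move=> a0 ab bt; rewrite lerBlDl -lee_fin -(@backwardD t a b)// EFinD leeD2l//.
apply: (@le_trans _ _ (\int[leb1]_(s in `]a, b]) cst (lam * backward t a x)%:E s)%E).
  apply: ge0_le_integral => //.
  - by apply: measurable_funTS; exact: measurable_esinks.
  - move=> s /=; rewrite in_itv/= => /andP[ls sb].
    apply: (le_trans (esink_upper _ _ _)); first exact: (le_trans a0 (ltW ls)).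
    rewrite lee_fin ler_wpM2l// backward_noninc// ?(ltW ls)//.
    exact: le_trans bt.
by rewrite integral_cst//= measure_itvoc// -EFinM lee_fin mulrAC.
Qed.

(** Where [u] is at most [M], the quadratic part of the reaction cancels at most the
    fraction [M] of its linear part. *)
Lemma backward_decr_ge t a b x (M : R) : 0 <= a -> a <= b -> b <= t ->
  M <= 1 -> (forall s y, a <= s -> u s y <= M) ->
  lam * (1 - M) * (b - a) * backward t b x <= backward t a x - backward t b x.
Proof.
move=> a0 ab bt M1 uM; rewrite lerBrDl -lee_fin -(@backwardD t a b)// EFinD leeD2l//.
have cM0 : 0 <= lam * (1 - M) by rewrite mulr_ge0// subr_ge0.
apply: (@le_trans _ _
  (\int[leb1]_(s in `]a, b]) cst (lam * (1 - M) * backward t b x)%:E s)%E).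
  by rewrite integral_cst//= measure_itvoc// -EFinM lee_fin mulrAC.
apply: ge0_le_integral => //.
- by move=> s _; rewrite lee_fin mulr_ge0// backward_ge0// (le_trans a0).
- by apply: measurable_funTS; exact: measurable_esinks.
- move=> s /=; rewrite in_itv/= => /andP[/ltW ls sb].
  have s0 := le_trans a0 ls.
  apply: le_trans (esink_lower _ _ s0 M1 _); last by move=> y; exact: uM.
  by rewrite lee_fin ler_wpM2l// backward_noninc.
Qed.

End mild_theory.

(** * Inequalities for functions of one real variable *)

Section real_lemmas.
Variable R : realType.
Implicit Types (f : R -> R) (a b h x e S t K : R).

(** A function whose increments are at most quadratic in the step has no
    increase at all: cut the interval into [n] pieces and let [n] grow. This
    takes the place of differentiation for functions known only through
    integral inequalities. *)
Lemma quadratic_increment_noninc f S t K : S <= t ->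
  (forall a b, S <= a -> a <= b -> b <= t -> b - a <= 2^-1 ->
    f b - f a <= K * (b - a) ^+ 2) ->
  f t <= f S.
Proof.
move=> St fK; rewrite -subr_le0 leNgt; apply/negP => g0.
set g := f t - f S in g0; pose D := t - S.
have D0 : 0 <= D by rewrite subr_ge0.
have [n [n0 nD ng]] : exists n : nat,
    [/\ 0 < n%:R :> R, D <= n%:R / 2 & K * D ^+ 2 < g * n%:R].
  pose y := 1 + 2 * D + `|K * D ^+ 2 / g|.
  have y0 : 0 <= y by rewrite !addr_ge0// mulr_ge0.
  have yn := archi_boundP y0.
  exists (Num.Def.archi_bound y).
  have ab0 : 0 <= `|K * D ^+ 2 / g| by [].
  split.
  - exact: le_lt_trans y0 yn.
  - by rewrite ler_pdivlMr// mulrC (le_trans _ (ltW yn))// /y; lra.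
  - rewrite -ltr_pdivrMl// mulrC; apply: le_lt_trans yn.
    by apply: (le_trans (ler_norm _)); rewrite /y; lra.
pose h := D / n%:R.
have h0 : 0 <= h by rewrite divr_ge0// ltW.
have hn : h * n%:R = D by rewrite /h divfK// gt_eqF.
have : g <= n%:R * (K * h ^+ 2).
  have -> : g = \sum_(0 <= i < n) (f (S + h * i.+1%:R) - f (S + h * i%:R)).
    rewrite (telescope_sumr (fun i => f (S + h * i%:R)))// mulr0 addr0 hn.
    by rewrite /g /D [S + _]addrC subrK.
  rewrite [X in _ <= X](_ : _ = \sum_(0 <= i < n) K * h ^+ 2); last first.
    by rewrite sumr_const_nat subn0 mulr_natl.
  apply: ler_sum_nat => i /andP[_ ni].
  have E1 : S + h * i.+1%:R - (S + h * i%:R) = h by rewrite -natr1; ring.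
  rewrite -[in X in _ <= X]E1; apply: fK.
  - by rewrite lerDl mulr_ge0.
  - by rewrite lerD2l ler_wpM2l// ler_nat.
  - rewrite -lerBrDl -/D -hn ler_wpM2l// ler_nat//.
  - by rewrite E1 /h ler_pdivrMr// mulrC.
apply/negP; rewrite -ltNge -(ltr_pM2r n0).
have -> : n%:R * (K * h ^+ 2) * n%:R = K * (h * n%:R) ^+ 2 by ring.
by rewrite hn.
Qed.

Lemma expR_le_quadratic x : 0 <= x <= 2^-1 -> expR x <= 1 + x + 2 * x ^+ 2.
Proof.
move=> /andP[x0 x1]; have h1 := expR_ge1Dx (- x).
rewrite -(@ler_pM2r _ (expR (- x))) ?expR_gt0// expRxMexpNx_1.
apply: (@le_trans _ _ ((1 + x + 2 * x ^+ 2) * (1 + - x))).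
  by rewrite expr2; nra.
by rewrite ler_wpM2l// !addr_ge0// mulr_ge0// sqr_ge0.
Qed.

Lemma expRN_le_quadratic x : 0 <= x -> expR (- x) <= 1 - x + x ^+ 2.
Proof.
move=> x0; have h1 := expR_ge1Dx x.
have x1 : 0 <= 1 - x + x ^+ 2 by have := sqr_ge0 (x - 2^-1); rewrite !expr2; nra.
rewrite -(@ler_pM2r _ (expR x)) ?expR_gt0// mulrC expRxMexpNx_1.
apply: (@le_trans _ _ ((1 - x + x ^+ 2) * (1 + x))); last by rewrite ler_wpM2l.
have := mulr_ge0 x0 (sqr_ge0 x).
by rewrite expr2; nra.
Qed.

Lemma expRN_small K a e : 0 <= K -> 0 < a -> 0 < e ->
  exists2 S : R, 0 <= S & forall s, S <= s -> K * expR (- (a * s)) <= e.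
Proof.
move=> K0 a0 e0; exists (K / (a * e)); first by rewrite divr_ge0// mulr_ge0// ltW.
move=> s Ss; have as0 : K / e <= a * s.
  by rewrite -ler_pdivrMl// (le_trans _ Ss)// invfM mulrCA.
rewrite expRN ler_pdivrMr ?expR_gt0//.
have := expR_ge1Dx (a * s); rewrite ler_pdivrMr// in as0.
by move=> h1; apply: (le_trans as0); rewrite mulrC ler_wpM2l ?ltW//; lra.
Qed.

End real_lemmas.

(** * Smoothing and exponential decay *)

Section smoothing.
Variables (R : realType) (d : nat).
Local Notation E := 'rV[R]_d.
Local Notation leb := (@lebesgue_rV R d).

Let pi4_ge1 : 1 <= 4 * pi :> R.
Proof. by have := pi_ge2 R; lra. Qed.

(** The normalization [t^(d/2)] exactly compensates the maximum of the heat
    kernel. *)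
Lemma powR_mul_heat_peak (t : R) : 0 < t ->
  t `^ (d%:R / 2) * (4 * pi * t) `^ (- (d%:R / 2)) =
  (4 * pi) `^ (- (d%:R / 2)).
Proof.
move=> t0; have a0 : 0 <= 4 * pi :> R by exact: le_trans pi4_ge1.
rewrite (powRM _ a0 (ltW t0)) mulrCA -powRD ?subrr.
  by rewrite powRr0 mulr1.
by rewrite (gt_eqF t0) implybT.
Qed.

Lemma powR_mul_heat_peak_le1 (t : R) : 0 < t ->
  t `^ (d%:R / 2) * (4 * pi * t) `^ (- (d%:R / 2)) <= 1.
Proof.
move=> t0; have a0 : 0 < 4 * pi :> R by exact: lt_le_trans pi4_ge1.
have : 1 `^ (d%:R / 2) <= (4 * pi) `^ (d%:R / 2) :> R.
  by apply: ge0_ler_powR => //; rewrite nnegrE ?ltW.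
by rewrite powR_mul_heat_peak// powRN invf_le1 ?powR_gt0// powR1.
Qed.

Lemma heat_peak_le (t : R) : (1 <= d)%N -> 1 <= t ->
  (4 * pi * t) `^ (- (d%:R / 2)) <= (Num.sqrt t)^-1.
Proof.
move=> d1 t1; have t0 : 0 < t by exact: lt_le_trans t1.
have h1 : t <= 4 * pi * t by rewrite ler_peMl// ltW.
rewrite powRN lef_pV2 ?posrE ?sqrtr_gt0// ?powR_gt0 ?(lt_le_trans t0)//.
apply: (@le_trans _ _ (t `^ (d%:R / 2))).
  rewrite -powR12_sqrt; last exact: ltW.
  apply: (ler_powR t1).
  by rewrite ler_peMl ?invr_ge0// ler1n.
by apply: ge0_ler_powR => //; rewrite nnegrE ltW// (lt_le_trans t0).
Qed.

Lemma heat_le_mass (t m M : R) (f : E -> R) x : 0 < t -> measurable_fun setT f ->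
  (forall y, 0 <= f y <= M) -> (\int[leb]_y (f y)%:E = m%:E)%E ->
  heat t f x <= (4 * pi * t) `^ (- (d%:R / 2)) * m.
Proof.
move=> t0 mf f0M fm; rewrite -lee_fin (heatE _ _ mf f0M) EFinM -fm.
apply: eheat_le_mass => //; first exact/measurable_EFinP.
by move=> y; rewrite lee_fin; case/andP: (f0M y).
Qed.

End smoothing.

Section decay.
Variables (R : realType) (d : nat) (q : nat -> R).
Hypotheses (d_ge1 : (1 <= d)%N) (q_law : offspring_law q).
Local Notation E := 'rV[R]_d.
Local Notation leb := (@lebesgue_rV R d).
Variables (phi : E -> R) (u : R -> E -> R) (m0 : R).
Hypotheses (mphi : measurable_fun setT phi) (phi01 : forall x, 0 <= phi x <= 1).
Hypothesis phi_mass : (\int[leb]_y (phi y)%:E = m0%:E)%E.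
Hypothesis u_mild : mild_solution q phi u.
Local Notation lam := (1 - q 1%N).

Let lam_gt0 : 0 < lam. Proof. by rewrite subr_gt0 offspring_q1_lt1. Qed.
Let m0_ge0 : 0 <= m0.
Proof.
rewrite -lee_fin -phi_mass; apply: integral_ge0 => y _.
by rewrite lee_fin; case/andP: (phi01 y).
Qed.

Lemma heat_ge0 (t : R) x : 0 <= heat t phi x.
Proof.
rewrite -lee_fin (heatE _ _ mphi phi01) eheat_ge0// => y.
by rewrite lee_fin; case/andP: (phi01 y).
Qed.

Lemma heat_le1 (t : R) x : heat t phi x <= 1.
Proof.
rewrite -lee_fin (heatE _ _ mphi phi01) eheat_le_cst//.
- exact/measurable_EFinP.
- by move=> y; rewrite lee_fin; case/andP: (phi01 y).
- by move=> y; rewrite lee_fin; case/andP: (phi01 y).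
Qed.

Lemma heat_eventually_le (e : R) : 0 < e ->
  exists2 T : R, 0 <= T & forall s y, T <= s -> heat s phi y <= e.
Proof.
move=> e0; exists (1 + (m0 / e) ^+ 2); first by rewrite addr_ge0// sqr_ge0.
move=> s y Ts; have me0 : 0 <= m0 / e by rewrite divr_ge0// ltW.
have s1 : 1 <= s by apply: le_trans Ts; rewrite lerDl sqr_ge0.
have s0 : 0 < s by exact: lt_le_trans s1.
apply: (le_trans (heat_le_mass _ s0 mphi phi01 phi_mass)).
apply: (@le_trans _ _ ((Num.sqrt s)^-1 * m0)).
  by rewrite ler_wpM2r// heat_peak_le.
rewrite ler_pdivrMl ?sqrtr_gt0// -ler_pdivrMr//.
rewrite -[leLHS]ger0_norm// -sqrtr_sqr ler_wsqrtr//.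
by rewrite (le_trans _ Ts)// lerDr.
Qed.

(** The reaction term being quadratic, once [u <= 1/2] at least half of the
    linear rate [1 - q 1] is effective; this is an exponential decay, obtained
    here in unit steps of time. *)
Lemma mild_exponential_decay : exists A del : R,
  [/\ 0 <= A, 0 < del &
    forall t x, 0 <= t -> u t x <= A * expR (- (del * t)) * heat t phi x].
Proof.
have [T T0 phiT] := @heat_eventually_le 2^-1 ltac:(by rewrite invr_gt0).
(* One unit of time divides the solution by [c] at least. *)
pose c := 1 + lam * 2^-1.
have c1 : 1 < c by rewrite ltrDl mulr_gt0.
have c0 : 0 < c by exact: lt_trans c1.
pose del := ln c; have del0 : 0 < del by rewrite ln_gt0.
exists (expR (del * (T + 1))), del; split=> // t x t0.
have p0 := heat_ge0 t x.
rewrite -expRD -mulrN -mulrDr.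
have [tT|Tt] := leP t T.
  apply: (le_trans (mild_le_heat q_law mphi phi01 u_mild x t0)).
  by rewrite ler_peMl// -[leLHS]expR0 ler_expR mulr_ge0 ?(ltW del0)//; lra.
have step n : T + n%:R <= t ->
    c ^+ n * backward u t (T + n%:R) x <= backward u t T x.
  elim: n => [|n IH]; first by rewrite expr0 mul1r addr0.
  rewrite -natr1 addrA => nt.
  have n0 : 0 <= T + n%:R by rewrite addr_ge0.
  have nt' : T + n%:R <= t by rewrite (le_trans _ nt)// lerDl.
  apply: le_trans (IH nt'); rewrite exprSr -mulrA ler_wpM2l ?exprn_ge0 ?(ltW c0)//.
  have := @backward_decr_ge _ _ _ q_law _ _ mphi phi01 u_mild t (T + n%:R)
    (T + n%:R + 1) x 2^-1 n0 ltac:(by rewrite lerDl) nt.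
  move=> /(_ ltac:(by rewrite invf_le1// ler1n)).
  have half s y : T + n%:R <= s -> u s y <= 2^-1.
    move=> Tns; have Ts : T <= s by rewrite (le_trans _ Tns)// lerDl.
    apply: le_trans (phiT s y Ts); apply: (mild_le_heat q_law mphi phi01 u_mild).
    exact: le_trans Ts.
  move=> /(_ half); rewrite /c; set wa := backward _ _ _ _; set wb := backward _ _ _ _.
  have -> : lam * (1 - 2^-1) * (T + n%:R + 1 - (T + n%:R)) * wa = lam * 2^-1 * wa.
    by field.
  by rewrite mulrDl mul1r; lra.
pose n := Num.truncn (t - T).
have tT0 : 0 <= t - T by rewrite subr_ge0 ltW.
have /andP[nl nu] := truncn_itv tT0; rewrite -/n in nl nu.
have nt : T + n%:R <= t by rewrite -lerBrDl.
have n0 : 0 <= T + n%:R by rewrite addr_ge0.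
have h1 : u t x <= backward u t (T + n%:R) x.
  by rewrite -[leLHS](backward_diag u); apply: (backward_noninc q_law mphi phi01 u_mild).
have h2 : backward u t T x <= heat t phi x.
  rewrite -(backward0 q_law mphi phi01 u_mild).
  by apply: (backward_noninc q_law mphi phi01 u_mild) => //; exact: ltW.
apply: (le_trans h1); rewrite -(ler_pM2l (exprn_gt0 n c0)).
apply: (le_trans (step n nt)); apply: (le_trans h2).
rewrite mulrA ler_peMl//.
rewrite -[c](lnK c0) -expRM_natl -expRD -[leLHS]expR0 ler_expR -/del -mulr_natl.
by rewrite -natr1 in nu; nra.
Qed.

End decay.

(** * Growth of the renormalized solution *)

Section growth.
Variables (R : realType) (d : nat) (q : nat -> R).
Hypotheses (d_ge1 : (1 <= d)%N) (q_law : offspring_law q).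
Local Notation E := 'rV[R]_d.
Local Notation leb := (@lebesgue_rV R d).
Variables (phi : E -> R) (u : R -> E -> R) (m0 : R).
Hypotheses (mphi : measurable_fun setT phi) (phi01 : forall x, 0 <= phi x <= 1).
Hypothesis phi_mass : (\int[leb]_y (phi y)%:E = m0%:E)%E.
Hypothesis u_mild : mild_solution q phi u.
Local Notation lam := (1 - q 1%N).
Local Notation z t r x := (expR (lam * r) * backward u t r x).

Let lam_gt0 : 0 < lam. Proof. by rewrite subr_gt0 offspring_q1_lt1. Qed.
Let lam_le1 : lam <= 1.
Proof. by rewrite gerBl; case: q_law => + _ _; exact. Qed.

Let z_ge0 t r x : 0 <= r -> 0 <= z t r x.
Proof.
by move=> r0; rewrite mulr_ge0 ?expR_ge0// (backward_ge0 u_mild).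
Qed.

(** The sink is at most [1 - q 1] times the solution, so that the factor
    [expR ((1 - q 1) * r)] makes up for it. *)
Lemma backward_growth t a b x : 0 <= a -> a <= b -> b <= t ->
  z t a x <= z t b x.
Proof.
move=> a0 ab bt; have b0 := le_trans a0 ab; have t0 := le_trans b0 bt.
rewrite -lerN2.
pose K := lam ^+ 2 * (expR (lam * t) * backward u t 0 x).
apply: (@quadratic_increment_noninc _ (fun r => - z t r x) a b K) => //.
move=> r s ar rs sb h1; rewrite opprK addrC.
have r0 := le_trans a0 ar; have s0 := le_trans r0 rs; have st := le_trans sb bt.
have h0 : 0 <= s - r by rewrite subr_ge0.
have hs : lam * s = lam * r + lam * (s - r) by ring.
rewrite {1}hs expRD; set h := s - r in h0 h1 *.
have := @backward_decr_le _ _ _ q_law _ _ mphi phi01 u_mild t r s x r0 rs st.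
rewrite -/h; set wr := backward u t r x; set ws := backward u t s x => dec.
have wr0 : 0 <= wr by apply: (backward_ge0 u_mild).
have ws0 : 0 <= ws by apply: (backward_ge0 u_mild).
have wrK : expR (lam * r) * wr <= expR (lam * t) * backward u t 0 x.
  apply: ler_pM; rewrite ?expR_ge0// ?ler_expR.
    by rewrite ler_wpM2l ?(ltW lam_gt0)// (le_trans rs).
  by apply: (backward_noninc q_law mphi phi01 u_mild) => //; rewrite (le_trans rs).
have y0 : 0 <= lam * h by rewrite mulr_ge0// ltW.
have e1 := expR_ge1Dx (lam * h).
have ws1 : (1 + lam * h) * ws <= expR (lam * h) * ws by rewrite ler_wpM2r.
have ws2 : (1 + lam * h) * ((1 - lam * h) * wr) <= (1 + lam * h) * ws.
  by rewrite ler_wpM2l ?addr_ge0//; lra.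
have ws3 : (1 - (lam * h) ^+ 2) * wr <= expR (lam * h) * ws.
  by apply: le_trans ws1; apply: le_trans ws2; rewrite mulrA expr2; lra.
apply: (@le_trans _ _ ((lam * h) ^+ 2 * (expR (lam * r) * wr))).
  rewrite -mulrA -mulrBr mulrCA ler_wpM2l ?expR_ge0//; lra.
have -> : (lam * h) ^+ 2 * (expR (lam * r) * wr) =
  lam ^+ 2 * (expR (lam * r) * wr) * h ^+ 2 by ring.
by rewrite ler_wpM2r ?sqr_ge0// ler_wpM2l ?sqr_ge0.
Qed.

Section late.
Variables (A del : R) (A0 : 0 <= A) (del0 : 0 < del).
Hypothesis u_decay : forall t x, 0 <= t -> u t x <= A * expR (- (del * t)).

(** Once [u] is exponentially small the quadratic part of the reaction is
    negligible compared with the linear one, with an integrable error. *)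
Lemma backward_growth_error t S x : 0 <= S -> S <= t ->
  A * expR (- (del * S)) <= 1 ->
  z t t x <= z t S x + lam * z t t x * (A / del * expR (- (del * S))).
Proof.
move=> S0 St AS; have t0 := le_trans S0 St.
pose Z := z t t x; have Z0 : 0 <= Z by apply: z_ge0.
(* A primitive of the bound [A * expR (- (del * r))] on the solution. *)
pose E r := - (A / del * expR (- (del * r))).
pose f r := z t r x - lam * Z * E r.
have Et : E t <= 0 by rewrite oppr_le0 !mulr_ge0 ?expR_ge0// invr_ge0 ltW.
suff : f t <= f S.
  rewrite /f -/Z => h; have : lam * Z * E t <= 0.
    by rewrite mulr_ge0_le0// mulr_ge0// ltW.
  by rewrite /E in h *; lra.
apply: (@quadratic_increment_noninc _ f S t
  (2 * lam ^+ 2 * Z + lam * Z * del)) => // a b Sa ab bt h1.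
have a0 := le_trans S0 Sa; have b0 := le_trans a0 ab.
have h0 : 0 <= b - a by rewrite subr_ge0.
pose M := A * expR (- (del * a)).
have M0 : 0 <= M by rewrite mulr_ge0 ?expR_ge0.
have M1 : M <= 1.
  apply: le_trans AS; rewrite ler_wpM2l// ler_expR lerN2 ler_wpM2l//.
  exact: ltW.
have uM s y : a <= s -> u s y <= M.
  move=> as_; have s0 := le_trans a0 as_.
  apply: (le_trans (u_decay y s0)).
  by rewrite ler_wpM2l// ler_expR lerN2 ler_wpM2l// ltW.
have := @backward_decr_ge _ _ _ q_law _ _ mphi phi01 u_mild t a b x M a0 ab bt M1 uM.
have zab := @backward_growth t a b x a0 ab bt.
have zbt := @backward_growth t b t x b0 bt (lexx _).
have za0 := @z_ge0 t a x a0; rewrite -/Z in zbt.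
have hb : lam * b = lam * a + lam * (b - a) by ring.
rewrite /f hb expRD in zab zbt *.
have Eab : M * (b - a) - M * del * (b - a) ^+ 2 <= E b - E a.
  rewrite /E; have -> : del * b = del * a + del * (b - a) by ring.
  rewrite opprD expRD.
  have := @expRN_le_quadratic _ (del * (b - a)) ltac:(by rewrite mulr_ge0// ltW).
  set y := expR (- (del * (b - a))) => hy.
  have -> : - (A / del * (expR (- (del * a)) * y)) -
      - (A / del * expR (- (del * a))) = M * ((1 - y) / del).
    by rewrite /M; ring.
  have -> : M * (b - a) - M * del * (b - a) ^+ 2 =
            M * ((del * (b - a) - (del * (b - a)) ^+ 2) / del).
    by field; rewrite gt_eqF.
  by rewrite ler_wpM2l// ler_pM2r ?invr_gt0//; lra.
set h := b - a in h0 h1 zab zbt Eab *.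
set wa := backward u t a x in za0 zab *; set wb := backward u t b x in zab zbt *.
set ea := expR (lam * a) in za0 zab zbt *; set eh := expR (lam * h) in zab zbt *.
move=> dec.
have eh1 : eh <= 1 + lam * h + 2 * (lam * h) ^+ 2.
  apply: expR_le_quadratic; rewrite mulr_ge0 ?(ltW lam_gt0)//=.
  by rewrite (le_trans _ h1)// ler_piMl.
have ea0 : 0 < ea by exact: expR_gt0.
have eh0 : 0 < eh by exact: expR_gt0.
set zb := ea * eh * wb in zab zbt *; set za := ea * wa in zab za0 *.
have D1 : lam * (1 - M) * h * zb <= eh * za - zb.
  have : ea * eh * (lam * (1 - M) * h * wb) <= ea * eh * (wa - wb).
    by rewrite ler_pM2l// mulr_gt0.
  by rewrite /za /zb; lra.
have D2 : eh * za <= (1 + lam * h + 2 * (lam * h) ^+ 2) * za by rewrite ler_wpM2r.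
have lh0 : 0 <= lam * h by rewrite mulr_ge0// ltW.
have D3 : lam * h * za <= lam * h * zb by rewrite ler_wpM2l.
have lhM0 : 0 <= lam * h * M by rewrite mulr_ge0.
have D4 : lam * h * M * zb <= lam * h * M * Z by rewrite ler_wpM2l.
have D5 : 2 * (lam * h) ^+ 2 * za <= 2 * (lam * h) ^+ 2 * Z.
  by rewrite ler_wpM2l ?(le_trans zab)// mulr_ge0// sqr_ge0.
have D6 : lam * Z * (M * h - M * del * h ^+ 2) <= lam * Z * (E b - E a).
  by rewrite ler_wpM2l// mulr_ge0// ltW.
have D7 : lam * Z * (M * (del * h ^+ 2)) <= lam * Z * (del * h ^+ 2).
  have lZ0 : 0 <= lam * Z by rewrite mulr_ge0// ltW.
  have dh0 : 0 <= del * h ^+ 2 by rewrite mulr_ge0 ?sqr_ge0// ltW.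
  by rewrite (ler_wpM2l lZ0)// ler_piMl.
clear - D1 D2 D3 D4 D5 D6 D7; rewrite exprMn in D2 D5; lra.
Qed.

End late.

(** The renormalized solution is comparable with the heat flow of the initial
    datum, and from a late time on it is the heat flow of its own past, up to a
    small multiple of the former. *)
Lemma backward_growth_late : exists B : R, [/\ 0 <= B,
  forall t x, 0 <= t -> expR (lam * t) * u t x <= B * heat t phi x &
  forall e : R, 0 < e -> exists2 S : R, 0 <= S & forall s t x, S <= s -> s <= t ->
    expR (lam * t) * u t x <= z t s x + e * heat t phi x].
Proof.
have [A [del [A0 del0 uA]]] :=
  mild_exponential_decay d_ge1 q_law mphi phi01 phi_mass u_mild.
have uA' t x : 0 <= t -> u t x <= A * expR (- (del * t)).
  move=> t0; apply: (le_trans (uA t x t0)); rewrite ler_piMr ?mulr_ge0 ?expR_ge0//.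
  exact: heat_le1.
have C0 : 0 <= A / del by rewrite divr_ge0// ltW.
have [S1 S10 S1P] := expRN_small A0 del0 (@ltr01 R).
(* From this time on the error term of [backward_growth_error] is at most half
   of the left-hand side, into which it can be absorbed. *)
have [S2 S20 S2P] := expRN_small C0 del0 (ltac:(by rewrite invr_gt0) : 0 < 2^-1 :> R).
pose S0 := Num.max S1 S2.
have S0_ge0 : 0 <= S0 by rewrite le_max S10.
pose B := 2 * expR (lam * S0).
have p0 t x := heat_ge0 mphi phi01 t x.
have diag t x : z t t x = expR (lam * t) * u t x by rewrite backward_diag.
have err s t x : S0 <= s -> s <= t ->
    z t t x <= z t s x + z t t x * (A / del * expR (- (del * s))).
  move=> Ss st; have s0 := le_trans S0_ge0 Ss; have t0 := le_trans s0 st.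
  have := @backward_growth_error A del A0 del0 uA' t s x s0 st.
  move=> /(_ (S1P s ltac:(by rewrite (le_trans _ Ss)// le_max lexx))).
  move=> /le_trans; apply; rewrite lerD2l.
  apply: ler_wpM2r; first by rewrite mulr_ge0 ?expR_ge0.
  by apply: ler_piMl => //; exact: z_ge0.
have zB t x : 0 <= t -> z t t x <= B * heat t phi x.
  move=> t0; have [tS|St] := leP t S0.
    rewrite diag; apply: (@le_trans _ _ (expR (lam * S0) * heat t phi x)).
      apply: ler_pM; rewrite ?expR_ge0//.
      - by case/andP: (mild_itv01 u_mild x t0).
      - by rewrite ler_expR ler_wpM2l// ltW.
      - exact: (mild_le_heat q_law mphi phi01 u_mild).
    by rewrite ler_wpM2r// /B ler_peMl ?expR_ge0// ler1n.
  have h1 := err S0 t x (lexx _) (ltW St).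
  have h2 : A / del * expR (- (del * S0)) <= 2^-1.
    by apply: S2P; rewrite le_max lexx orbT.
  have Z0 : 0 <= z t t x by exact: z_ge0.
  have h3 := ler_wpM2l Z0 h2.
  have h4 : z t S0 x <= expR (lam * S0) * heat t phi x.
    rewrite ler_wpM2l ?expR_ge0// -(backward0 q_law mphi phi01 u_mild).
    by apply: (backward_noninc q_law mphi phi01 u_mild) => //; exact: ltW.
  by rewrite /B; lra.
exists B; split.
- by rewrite mulr_ge0 ?expR_ge0.
- by move=> t x t0; rewrite -diag zB.
move=> e e0; have B0 : 0 <= B * (A / del) by rewrite mulr_ge0// mulr_ge0 ?expR_ge0.
have [S3 S30 S3P] := expRN_small B0 del0 e0.
exists (Num.max S0 S3); first by rewrite le_max S0_ge0.
move=> s t x; rewrite ge_max => /andP[S0s S3s] st; rewrite -diag.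
have s0 := le_trans S0_ge0 S0s; have t0 := le_trans s0 st.
apply: (le_trans (err s t x S0s st)); rewrite lerD2l.
apply: (@le_trans _ _ (B * heat t phi x * (A / del * expR (- (del * s))))).
  by rewrite ler_wpM2r ?zB// mulr_ge0 ?expR_ge0.
have := ler_wpM2r (p0 t x) (S3P s S3s); lra.
Qed.

End growth.

(** * Large-time behaviour of the heat flow *)

Section heat_asymptotics.
Variables (R : realType) (d : nat).
Local Notation E := 'rV[R]_d.
Local Notation leb := (@lebesgue_rV R d).
Local Notation ker := (@heat_kernel R d).

(** When [a] is the smaller of the two in absolute value the difference is at
    most [expR (- a ^+ 2) * (b ^+ 2 - a ^+ 2)], and the Gaussian factor absorbs
    [2 * `|a| <= 1 + a ^+ 2]. *)
Lemma gaussian_lipschitz (a b : R) :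
  `|expR (- a ^+ 2) - expR (- b ^+ 2)| <= 2 * `|a - b|.
Proof.
wlog ab : a b / a ^+ 2 <= b ^+ 2.
  move=> W; have [|/ltW] := leP (a ^+ 2) (b ^+ 2); first exact: W.
  by move/W; rewrite distrC (distrC b).
rewrite ger0_norm ?subr_ge0 ?ler_expR ?lerN2//.
have [h1|/ltW h1] := leP 1 `|a - b|.
  have := expR_gt0 (- b ^+ 2); have : expR (- a ^+ 2) <= 1.
    by rewrite -expR0 ler_expR oppr_le0 sqr_ge0.
  by lra.
have : expR (- a ^+ 2) * (1 - (b ^+ 2 - a ^+ 2)) <= expR (- b ^+ 2).
  rewrite (_ : - b ^+ 2 = - a ^+ 2 + - (b ^+ 2 - a ^+ 2)); last by ring.
  by rewrite expRD ler_wpM2l ?expR_ge0// expR_ge1Dx.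
set ea := expR (- a ^+ 2) => h2.
have ea0 : 0 < ea by exact: expR_gt0.
have ea1 : ea <= 1 by rewrite /ea -expR0 ler_expR oppr_le0 sqr_ge0.
have ea2 : ea * (2 * `|a|) <= 1.
  rewrite -[leRHS](expRxMexpNx_1 (a ^+ 2)) mulrC ler_wpM2r ?expR_ge0//.
  apply: le_trans (expR_ge1Dx (a ^+ 2)); have := sqr_ge0 (`|a| - 1).
  by rewrite -(real_normK (num_real a)); lra.
have h4 : b ^+ 2 - a ^+ 2 <= `|a - b| * (2 * `|a| + `|a - b|).
  rewrite subr_sqr -(distrC b a) (le_trans (ler_norm _))// normrM ler_wpM2l//.
  rewrite (_ : b + a = (b - a) + (a + a)); last by ring.
  rewrite (le_trans (ler_normD _ _))// addrC lerD2r (le_trans (ler_normD _ _))//.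
  by lra.
have h5 : ea * (b ^+ 2 - a ^+ 2) <= ea * (`|a - b| * (2 * `|a| + `|a - b|)).
  by rewrite ler_wpM2l// ltW.
have n0 : 0 <= `|a - b| by [].
have h6 : `|a - b| * (ea * (2 * `|a|)) <= `|a - b| by rewrite ler_piMr.
have h7 : ea * `|a - b| ^+ 2 <= `|a - b|.
  by rewrite expr2 mulrA ler_piMl// mulr_ile1// ltW.
by rewrite expr2 in h7; lra.
Qed.

(** Products are telescoped one factor at a time. *)
Lemma prod_lipschitz n (a b : 'I_n -> R) :
  (forall i, 0 <= a i <= 1) -> (forall i, 0 <= b i <= 1) ->
  `|\prod_i a i - \prod_i b i| <= \sum_i `|a i - b i|.
Proof.
elim: n a b => [|n IH] a b a01 b01; first by rewrite !big_ord0 subrr normr0.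
rewrite !big_ord_recl.
set pa := \prod_(i < n) _; set pb := \prod_(i < n) _.
have h : `|pa - pb| <= \sum_(i < n) `|a (lift ord0 i) - b (lift ord0 i)|.
  exact: IH.
have pa01 : 0 <= pa <= 1.
  by rewrite prodr_ile1 ?prodr_ge0// => i _; case/andP: (a01 (lift ord0 i)).
have /andP[b0 b1] := b01 ord0; have /andP[pa0 pa1] := pa01.
rewrite (_ : _ - _ = (a ord0 - b ord0) * pa + b ord0 * (pa - pb)); last by ring.
apply: (le_trans (ler_normD _ _)); rewrite !normrM lerD//.
  by rewrite ler_piMr// ger0_norm.
by apply: le_trans h; rewrite ler_piMl// ger0_norm.
Qed.

Definition l1norm (y : E) : R := \sum_i `|y 0 i|.

Lemma measurable_l1norm : measurable_fun setT l1norm.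
Proof.
apply: measurable_sum => i; apply: measurableT_comp => //.
exact: measurable_mx_coord.
Qed.

Lemma l1norm_ge0 y : 0 <= l1norm y.
Proof. by rewrite /l1norm sumr_ge0. Qed.

Local Notation peak t := ((4 * pi * t) `^ (- (d%:R / 2))).
Local Notation shift t y := (Num.min 1 (l1norm y / Num.sqrt t)).

(** Moving the pole of the heat kernel by [y] is not felt at the scale
    [sqrt t] of the kernel, uniformly in space. *)
Lemma heat_kernel_shift (t : R) x y : 0 < t ->
  `|ker t (x - y) - ker t x| <= peak t * shift t y.
Proof.
move=> t0; have st0 : 0 < Num.sqrt t by rewrite sqrtr_gt0.
have kerE (z : E) : ker t z =
    peak t * \prod_i expR (- (z 0 i / (2 * Num.sqrt t)) ^+ 2).
  rewrite /heat_kernel -expR_sum; congr (_ * expR _).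
  rewrite -sumrN mulr_suml; apply: eq_bigr => i _.
  rewrite -[in LHS](sqr_sqrtr (ltW t0)); field.
  exact: lt0r_neq0.
have e01 (z : E) i : 0 <= expR (- (z 0 i / (2 * Num.sqrt t)) ^+ 2) <= 1.
  by rewrite expR_ge0 -[leRHS]expR0 ler_expR oppr_le0 sqr_ge0.
rewrite !kerE -mulrBr normrM ger0_norm ?powR_ge0// ler_wpM2l ?powR_ge0//.
rewrite le_min; apply/andP; split.
  have p01 (z : E) : 0 <= \prod_i expR (- (z 0 i / (2 * Num.sqrt t)) ^+ 2) <= 1.
    by rewrite prodr_ge0 ?prodr_ile1.
  have /andP[? ?] := p01 x; have /andP[? ?] := p01 (x - y).
  by rewrite ler_norml; apply/andP; split; lra.
apply: (le_trans (prod_lipschitz (e01 _) (e01 _))).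
rewrite /l1norm mulr_suml; apply: ler_sum => i _.
apply: (le_trans (gaussian_lipschitz _ _)).
have -> : (x - y) 0 i / (2 * Num.sqrt t) - x 0 i / (2 * Num.sqrt t) =
    - y 0 i / (2 * Num.sqrt t) by rewrite !mxE; ring.
rewrite normrM normrN (@ger0_norm _ (_^-1)); last first.
  by rewrite invr_ge0 mulr_ge0// ltW.
rewrite le_eqVlt; apply/orP; left; apply/eqP; field.
exact: lt0r_neq0.
Qed.

Section fixed.
Variables (f : E -> R) (M m : R).
Hypotheses (mf : measurable_fun setT f) (f0M : forall y, 0 <= f y <= M).
Hypothesis f_mass : (\int[leb]_y (f y)%:E = m%:E)%E.

Let f0 y : 0 <= f y. Proof. by case/andP: (f0M y). Qed.

Let mEf : measurable_fun setT (EFin \o f). Proof. exact/measurable_EFinP. Qed.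

Let shift_ge0 t y : 0 <= shift t y.
Proof. by rewrite le_min ler01 divr_ge0 ?l1norm_ge0 ?sqrtr_ge0. Qed.

Let measurable_shift t : measurable_fun setT (fun y : E => shift t y).
Proof.
apply: measurable_minr => //; apply: measurable_funM => //.
exact: measurable_l1norm.
Qed.

(** Relative to the maximum of the heat kernel, this bounds the error made when
    all the mass of [f] is moved to the origin. *)
Let loss t := (\int[leb]_y (shift t y * f y)%:E)%E.

Let measurable_shift_f t : measurable_fun setT (fun y : E => (shift t y * f y)%:E).
Proof. by apply/measurable_EFinP; exact: measurable_funM. Qed.

Let loss_ge0 t : (0 <= loss t)%E.
Proof. by apply: integral_ge0 => y _; rewrite lee_fin mulr_ge0. Qed.

Let heat_loss (t : R) x : 0 < t ->
  ((heat t f x)%:E <= (m * ker t x)%:E + (peak t)%:E * loss t)%E /\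
  ((m * ker t x)%:E <= (heat t f x)%:E + (peak t)%:E * loss t)%E.
Proof.
move=> t0; rewrite (heatE _ _ mf f0M) mulrC EFinM -f_mass /eheat t0/=.
have mk : measurable_fun setT (fun y : E => (ker t (x - y))%:E).
  by apply/measurable_EFinP; exact: measurable_heat_kernel.
rewrite /loss -!ge0_integralZl//; last 4 first.
- by move=> y _; rewrite lee_fin mulr_ge0.
- by rewrite lee_fin powR_ge0.
- by move=> y _; rewrite lee_fin.
- by rewrite lee_fin heat_kernel_ge0.
have mx : measurable_fun setT (fun y : E => (ker t x)%:E * (f y)%:E)%E.
  exact: measurable_funeM.
have my : measurable_fun setT (fun y : E => (ker t (x - y))%:E * (f y)%:E)%E.
  exact: emeasurable_funM.
have ms : measurable_fun setT (fun y : E => (peak t)%:E * (shift t y * f y)%:E)%E.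
  exact: measurable_funeM.
have s0 y : (0 <= (peak t)%:E * (shift t y * f y)%:E)%E.
  by rewrite mule_ge0// lee_fin ?powR_ge0// mulr_ge0.
have k0 z y : (0 <= (ker t z)%:E * (f y)%:E)%E.
  by rewrite mule_ge0// lee_fin// heat_kernel_ge0.
split; rewrite -ge0_integralD//; apply: ge0_le_integral => //.
all: try exact: emeasurable_funD.
all: try by move=> y _; rewrite adde_ge0.
all: move=> y _; rewrite -!EFinM -EFinD lee_fin mulrA -mulrDl ler_wpM2r//.
all: by have := heat_kernel_shift x y t0; rewrite ler_norml => /andP[? ?]; lra.
Qed.

(** By dominated convergence, along the squares of the integers, whose square
    root is explicit; the loss is nonincreasing in time. *)
Let loss_small (e : R) : 0 < e ->
  exists2 T : R, 1 <= T & forall t, T <= t -> (loss t <= e%:E)%E.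
Proof.
move=> e0; pose a n : R := n.+1%:R ^+ 2.
have a0 n : 0 < a n by rewrite exprn_gt0.
have sa n : Num.sqrt (a n) = n.+1%:R by rewrite sqrtr_sqr ger0_norm.
have cv y : (fun n => (shift (a n) y * f y)%:E) n @[n --> \oo] --> (cst 0 y : \bar R).
  apply: cvg_EFin; first exact: nearW.
  apply: (@squeeze_cvgr _ _ _ _ (cst 0) (fun n => l1norm y * f y * harmonic n)).
  - apply: nearW => n /=; rewrite mulr_ge0//= sa mulrAC ler_wpM2r//.
    by rewrite ge_min lexx orbT.
  - exact: cvg_cst.
  - rewrite -[X in _ --> X](mulr0 (l1norm y * f y)).
    by apply: cvgM; [exact: cvg_cst|exact: cvg_harmonic].
have int_f : leb.-integrable setT (EFin \o f).
  apply/integrableP; split=> //.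
  under eq_integral => y _ do rewrite gee0_abs ?lee_fin//.
  by rewrite f_mass ltry.
have dom : \forall y \ae leb, forall n : nat, setT y ->
    (`|(shift (a n) y * f y)%:E| <= (EFin \o f) y)%E.
  apply: aeW => y n _ /=; rewrite lee_fin ger0_norm ?mulr_ge0//.
  by rewrite ler_piMl// ge_min lexx.
have [_ _] := @dominated_convergence _ _ _ leb setT measurableT
  (fun n y => (shift (a n) y * f y)%:E) (cst 0)%E (EFin \o f)
  (fun n => measurable_shift_f (a n)) (@measurable_cst _ _ _ _ _ _) 
  (aeW _ (fun y _ => cv y)) int_f dom.
rewrite integral0 => /fine_cvgP[fin /cvgrPdist_le/(_ e e0) small].
near \oo => n.
have fn : loss (a n) \is a fin_num by near: n; exact: fin.
have sn : `|0 - fine (loss (a n))| <= e by near: n; exact: small.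
exists (a n).
  by rewrite -[leLHS](expr1n _ 2) lerXn2r ?nnegrE// ler1n.
move=> t ant; apply: (@le_trans _ _ (loss (a n))).
  apply: ge0_le_integral => //.
  - by move=> y _; rewrite lee_fin mulr_ge0.
  move=> y _; rewrite lee_fin ler_wpM2r//.
  rewrite le_min ge_min lexx/= ge_min; apply/orP; right.
  rewrite ler_wpM2l ?l1norm_ge0// lef_pV2 ?posrE ?sqrtr_gt0//.
    exact: ler_wsqrtr.
  exact: lt_le_trans ant.
rewrite -(fineK fn) lee_fin.
by rewrite sub0r normrN in sn; exact: (le_trans (ler_norm _)).
Unshelve. all: by end_near. Qed.

(** At large times the heat flow of an integrable function only remembers its
    mass, up to an error which is small with respect to [t^(-d/2)] uniformly in
    space. *)
Lemma heat_asymptotics (e : R) : 0 < e ->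
  exists2 T : R, 1 <= T & forall t x, T <= t ->
    t `^ (d%:R / 2) * `|heat t f x - m * ker t x| <= e.
Proof.
move=> e0; have [T T1 Tl] := loss_small e0; exists T => // t x Tt.
have t0 : 0 < t by rewrite (lt_le_trans _ Tt)// (lt_le_trans _ T1).
have [h1 h2] := heat_loss x t0.
have hl : ((peak t)%:E * loss t <= (peak t * e)%:E)%E.
  by rewrite EFinM lee_wpmul2l ?Tl// lee_fin powR_ge0.
have {}h1 : heat t f x <= m * ker t x + peak t * e.
  by rewrite -lee_fin (le_trans h1)// EFinD leeD2l.
have {}h2 : m * ker t x <= heat t f x + peak t * e.
  by rewrite -lee_fin (le_trans h2)// EFinD leeD2l.
apply: (@le_trans _ _ (t `^ (d%:R / 2) * (peak t * e))).
  rewrite ler_wpM2l ?powR_ge0// ler_norml; apply/andP; split; lra.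
by rewrite mulrA ler_piMl ?powR_mul_heat_peak_le1// ltW.
Qed.

End fixed.
End heat_asymptotics.

(** * The Brownian motion of several particles *)

Section measurable_induction.
Context d (T : measurableType d) (R : realType).
Import HBNNSimple.

(** The standard machine: indicators, then simple functions, then nondecreasing
    limits. *)
Lemma nonneg_measurable_ind (P : (T -> R) -> Prop) :
  (forall A, measurable A -> P \1_A) ->
  (forall c (f g : T -> R), 0 <= c -> (forall x, 0 <= f x) -> (forall x, 0 <= g x) ->
    measurable_fun setT f -> measurable_fun setT g ->
    P f -> P g -> P (fun x => c * f x + g x)) ->
  (forall (F : (T -> R)^nat) (f : T -> R), (forall n x, 0 <= F n x) ->
    (forall n, measurable_fun setT (F n)) ->
    (forall x, {homo F ^~ x : n m / (n <= m)%N >-> n <= m}) ->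
    (forall x, F ^~ x @ \oo --> f x) -> (forall n, P (F n)) -> P f) ->
  forall f : T -> R, measurable_fun setT f -> (forall x, 0 <= f x) -> P f.
Proof.
move=> P1 PD Plim f mf f0.
have P_simple (g : {nnsfun T >-> R}) : P g.
  have -> : (g : T -> R) = fun x =>
      \sum_(y <- fset_set (range g)) y * \1_(g @^-1` [set y]) x.
    by apply/funext => x; rewrite fimfunE fsbig_finite.
  have : forall y, y \in (fset_set (range g) : seq R) -> 0 <= y.
    by move=> y; rewrite in_fset_set// inE => -[x _ <-].
  elim: (fset_set (range g) : seq R) => [_|y s IH s0].
    rewrite (_ : (fun x => _) = \1_set0); first exact: P1.
    by apply/funext => x; rewrite big_nil indic0.
  have s0' z : z \in s -> 0 <= z by move=> zs; apply: s0; rewrite inE zs orbT.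
  rewrite (_ : (fun x => _) = fun x => y * \1_(g @^-1` [set y]) x +
      \sum_(z <- s) z * \1_(g @^-1` [set z]) x); last first.
    by apply/funext => x; rewrite big_cons.
  apply: PD => //.
  - by apply: s0; rewrite mem_head.
  - move=> x; rewrite big_seq sumr_ge0// => z zs.
    by apply: mulr_ge0; [exact: s0'|rewrite indicE].
  - by apply: measurable_sum => z; exact: measurable_funM.
  - by apply: P1.
  - exact: IH.
have mEf : measurable_fun setT (EFin \o f) by exact/measurable_EFinP.
pose F := nnsfun_approx measurableT mEf.
apply: (Plim (fun n => F n : T -> R)) => //.
- by move=> x m n mn; exact/lefP/nd_nnsfun_approx.
- move=> x; have := cvg_nnsfun_approx measurableT mEf.
  move=> /(_ (fun y _ => ltac:(by rewrite lee_fin; exact: f0)) x I).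
  by move/fine_cvgP => [_].
Qed.

End measurable_induction.

Section hat_measurability.
Variables (R : realType) (d : nat).
Local Notation E := 'rV[R]_d.

Definition config_sum (f : E -> R) (mu : config R d) : R :=
  \sum_(x <- enum_mset mu) f x.

Lemma config_sum_of_mx f m (M : 'M[R]_(m, d)) :
  config_sum f (config_of_mx M) = \sum_i f (row i M).
Proof.
rewrite /config_sum (perm_big _ (perm_eq_seq_mset _)) big_map.
by rewrite big_enum.
Qed.

(** Counting the particles in an open set is lower semicontinuous: a particle
    of an open set stays there under small perturbations. *)
Let measurable_count_open (U : set E) : open U ->
  measurable_fun setT (config_sum \1_U).
Proof.
move=> oU; apply: (measurability _ (RGenOInfty.measurableE R)) => _ [_ [a ->] <-].
rewrite setTI; apply: sub_sigma_algebra => m /=.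
rewrite openE => M /=; rewrite in_itv/= andbT config_sum_of_mx => aM.
have near_row i : U (row i M) -> \forall N \near M, U (row i N).
  move=> UM; have /nbhs_ballP[e /= e0 eU] : nbhs (row i M) U.
    exact: open_nbhs_nbhs.
  apply/nbhs_ballP; exists e => //= N MN; apply: eU; split => // k j.
  by rewrite !mxE; exact: MN.2.
have : \forall N \near M, forall i, U (row i M) -> U (row i N).
  apply: (@filter_forall _ 'I_m (fun i (N : 'M[R]_(m, d)) =>
    U (row i M) -> U (row i N)) (nbhs M) (nbhs_filter M)) => i.
  have [/near_row|nU] := pselect (U (row i M)).
    by apply: filterS.
  by apply: nearW.
apply: filterS => N UN /=; rewrite in_itv/= andbT config_sum_of_mx.
apply: (lt_le_trans aM); apply: ler_sum => i _; rewrite !indicE ler_nat.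
have [|//] := boolP (row i M \in U); rewrite inE => /UN UiN.
by rewrite mem_set.
Qed.

Let cvg_config_sum (F : (E -> R)^nat) f : (forall x, F ^~ x @ \oo --> f x) ->
  forall mu, (fun n => config_sum (F n) mu) @ \oo --> config_sum f mu.
Proof.
move=> Ff mu; rewrite /config_sum; elim: (enum_mset mu : seq _) => [|x s IH].
  under eq_fun do rewrite big_nil.
  by rewrite big_nil; exact: cvg_cst.
under eq_fun do rewrite big_cons.
by rewrite big_cons; apply: cvgD.
Qed.

(** Open sets are stable under intersection and generate the Borel sets; counts
    are additive and pass to monotone limits, so a monotone class argument
    applies. *)
Let measurable_count (A : set E) : measurable A ->
  measurable_fun setT (config_sum \1_A).
Proof.
apply: (@lambda_system_subset _ [set U : set E | open U] _ setT
  [set A | measurable_fun setT (config_sum \1_A)]) => //.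
- by move=> U V; exact: openI.
- split => //.
  + by apply: measurable_count_open; exact: openT.
  + move=> B C CB mB mC /=.
    rewrite (_ : config_sum _ = fun mu => config_sum \1_B mu - config_sum \1_C mu).
      exact: measurable_funB.
    apply/funext => mu; rewrite /config_sum -sumrB; apply: eq_bigr => x _.
    rewrite !indicE in_setD.
    have [xC|xC] := boolP (x \in C); last by rewrite andbT subr0.
    by rewrite (mem_set (CB _ (set_mem xC))) subrr.
  + move=> F ndF mF /=.
    apply: (@measurable_fun_cvg _ _ _ _ (fun n => config_sum \1_(F n))) => // mu _.
    apply: cvg_config_sum => x; rewrite indicE.
    have [|nF] := boolP (x \in \bigcup_n F n).
      rewrite inE => -[k _ Fkx]; apply: cvg_near_cst; near=> n.
      rewrite indicE mem_set//; have kn : (k <= n)%N by near: n; exists k.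
      by move: (ndF _ _ kn) => /subsetPset; exact.
    apply: cvg_near_cst; near=> n.
    rewrite indicE memNset// => Fnx; move: nF; rewrite notin_setE; apply.
    by exists n.
Unshelve. all: by end_near. Qed.

Lemma measurable_config_sum (f : E -> R) :
  measurable_fun setT f -> (forall x, 0 <= f x) ->
  measurable_fun setT (config_sum f).
Proof.
move: f; apply: nonneg_measurable_ind; first exact: measurable_count.
- move=> c f g _ _ _ _ _ mf mg.
  rewrite (_ : config_sum _ = fun mu => c * config_sum f mu + config_sum g mu).
    by apply: measurable_funD => //; exact: measurable_funM.
  by apply/funext => mu; rewrite /config_sum big_split/= mulr_sumr.
- move=> F f _ _ _ Ff mF.
  apply: (@measurable_fun_cvg _ _ _ _ (fun n => config_sum (F n))) => // mu _.
  exact: cvg_config_sum.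
Qed.

(** The product over the particles is the exponential of a sum over them, which
    is a linear functional; the particles at which [phi] vanishes are counted
    apart. *)
Lemma measurable_hat (phi : E -> R) : measurable_fun setT phi ->
  (forall x, 0 <= phi x <= 1) -> measurable_fun setT (@hat R d phi).
Proof.
move=> mphi phi01; pose Z := phi @^-1` [set 0].
have mZ : measurable Z by rewrite -[Z]setTI; exact: mphi.
rewrite (_ : hat phi = fun mu => if config_sum \1_Z mu == 0
    then expR (- config_sum (fun x => - ln (phi x)) mu) else 0).
  apply: measurable_fun_ifT => //.
    by apply: measurable_fun_eqr => //; exact: measurable_count.
  apply: measurableT_comp => //; apply: measurableT_comp => //.
  apply: measurable_config_sum.
    by apply: measurableT_comp => //; exact: measurableT_comp.
  by move=> x; rewrite oppr_ge0 ln_le0//; case/andP: (phi01 x).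
apply/funext => mu; rewrite /hat /config_sum psumr_eq0; last first.
  by move=> x _; rewrite indicE ler0n.
case: ifPn => [/allP nZ|/allPn[x xmu xZ]].
  rewrite sumrN opprK expR_sum; apply: eq_big_seq => x xmu.
  rewrite lnK// posrE lt0r; case/andP: (phi01 x) => -> _; rewrite andbT.
  have := nZ x xmu; rewrite /= indicE; apply: contraTneq => phix.
  by rewrite mem_set ?oner_eq0.
apply/eqP; rewrite prodf_seq_eq0; apply/hasP; exists x => //=.
move: xZ; rewrite indicE; have [|] := boolP (x \in Z); last by rewrite eqxx.
by rewrite inE => /eqP.
Qed.

End hat_measurability.

Section brownian_integral.
Variables (R : realType) (d : nat).
Local Notation E := 'rV[R]_d.
Local Notation leb := (@lebesgue_rV R d).
Local Notation ker := (@heat_kernel R d).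

Lemma integral_heat_measure t x (f : E -> R) : 0 < t ->
  measurable_fun setT f -> (forall y, 0 <= f y) ->
  (\int[heat_measure t x]_y (f y)%:E = \int[leb]_y (ker t (x - y) * f y)%:E)%E.
Proof.
move=> t0; move: f; have mk := @measurable_heat_kernel R d t x.
apply: nonneg_measurable_ind.
- move=> A mA; transitivity (heat_measure t x A).
    by rewrite integral_indic// setIT.
  rewrite /heat_measure t0 integral_mkcond epatch_indic; apply: eq_integral => y _ /=.
  by rewrite -EFinM.
- move=> c f g c0 f0 g0 mf mg Pf Pg.
  have k0 y : 0 <= ker t (x - y) by exact: heat_kernel_ge0.
  under eq_integral do rewrite EFinD EFinM.
  rewrite ge0_integralD//; first last.
  - exact/measurable_EFinP.
  - by move=> y _; rewrite lee_fin.
  - by apply: measurable_funeM; exact/measurable_EFinP.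
  - by move=> y _; rewrite -EFinM lee_fin mulr_ge0.
  rewrite ge0_integralZl//; first last.
  - by move=> y _; rewrite lee_fin.
  - exact/measurable_EFinP.
  rewrite Pf Pg -ge0_integralZl//; first last.
  - by move=> y _; rewrite lee_fin mulr_ge0.
  - by apply/measurable_EFinP; exact: measurable_funM.
  rewrite -ge0_integralD//; first last.
  - by apply/measurable_EFinP; exact: measurable_funM.
  - by move=> y _; rewrite lee_fin mulr_ge0.
  - by apply: measurable_funeM; apply/measurable_EFinP; exact: measurable_funM.
  - by move=> y _; apply: mule_ge0; rewrite lee_fin// mulr_ge0.
  apply: eq_integral => y _; rewrite -EFinM -EFinD; congr EFin; ring.
move=> F f F0 mF ndF Ff PF.
have k0 y : 0 <= ker t (x - y) by exact: heat_kernel_ge0.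
transitivity (limn (fun n => \int[heat_measure t x]_y (F n y)%:E))%E.
  rewrite -monotone_convergence//.
  - apply: eq_integral => y _; apply/esym/cvg_lim => //.
    by apply: cvg_EFin; [exact: nearW|exact: Ff].
  - by move=> n; exact/measurable_EFinP.
  - by move=> n y _; rewrite lee_fin.
  - by move=> y _ m n mn; rewrite lee_fin ndF.
under eq_fun do rewrite PF.
rewrite -monotone_convergence//.
- apply: eq_integral => y _; apply/cvg_lim => //.
  apply: cvg_EFin; first exact: nearW.
  by apply: cvgM; [exact: cvg_cst|exact: Ff].
- by move=> n; apply/measurable_EFinP; exact: measurable_funM.
- by move=> n y _; rewrite lee_fin mulr_ge0.
- by move=> y _ m n mn; rewrite lee_fin ler_wpM2l// ndF.
Qed.

(** Independent particles: the integral of the product is the product of the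
    integrals. *)
Lemma integral_brownian t mu (phi : E -> R) : 0 < t ->
  measurable_fun setT phi -> (forall x, 0 <= phi x <= 1) ->
  \int[brownian t mu]_nu hat phi nu = hat (heat t phi) mu.
Proof.
move=> t0 mphi phi01.
have hat0 nu : 0 <= @hat R d phi nu.
  by rewrite prodr_ge0// => y _; case/andP: (phi01 y).
have mhat := measurable_hat mphi phi01.
rewrite /Rintegral ge0_integral_pushforward//; first last.
- by move=> nu _; rewrite lee_fin.
- exact/measurable_EFinP.
- exact: measurable_config_of_tuple.
rewrite preimage_setT.
rewrite (eq_integral (fun s : (size (enum_mset mu)).-tuple E =>
    (\prod_i phi (tnth s i))%:E)); last first.
  move=> s _ /=; congr EFin.
  by rewrite /hat (perm_big _ (perm_eq_seq_mset _)) big_tuple.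
rewrite (@integral_tuple_measure _ _ _ _ _ (fun=> phi)
  (fun i => heat t phi (tnth (in_tuple (enum_mset mu)) i)))//.
- by rewrite /hat [in RHS]big_tnth.
- by move=> i y; case/andP: (phi01 y).
move=> i; rewrite integral_heat_measure//; last by move=> y; case/andP: (phi01 y).
by rewrite (heatE _ _ mphi phi01) /eheat t0.
Qed.

End brownian_integral.

(** * One particle *)

Section one_particle.
Variables (R : realType) (d : nat) (q : nat -> R).
Hypotheses (d_ge1 : (1 <= d)%N) (q_law : offspring_law q).
Local Notation E := 'rV[R]_d.
Local Notation leb := (@lebesgue_rV R d).
Local Notation ker := (@heat_kernel R d).

Lemma integral_heat (t M : R) (f : E -> R) : measurable_fun setT f ->
  (forall y, 0 <= f y <= M) ->
  (\int[leb]_x (heat t f x)%:E = \int[leb]_x (f x)%:E)%E.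
Proof.
move=> mf f0M; under eq_integral do rewrite (heatE _ _ mf f0M).
apply: integral_eheat; first exact/measurable_EFinP.
by move=> y; rewrite lee_fin; case/andP: (f0M y).
Qed.

Lemma measurable_heat (t M : R) (f : E -> R) : measurable_fun setT f ->
  (forall y, 0 <= f y <= M) -> measurable_fun setT (heat t f).
Proof.
move=> mf f0M; apply/measurable_EFinP.
apply: (eq_measurable_fun (eheat t (EFin \o f))).
  by move=> x _; rewrite -(heatE _ _ mf f0M).
apply: measurable_eheat; first exact/measurable_EFinP.
by move=> y; rewrite lee_fin; case/andP: (f0M y).
Qed.

Variables (phi : E -> R) (u : R -> E -> R) (m0 : R).
Hypotheses (mphi : measurable_fun setT phi) (phi01 : forall x, 0 <= phi x <= 1).
Hypothesis phi_mass : (\int[leb]_y (phi y)%:E = m0%:E)%E.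
Hypothesis u_mild : mild_solution q phi u.
Local Notation lam := (1 - q 1%N).

Let m0_ge0 : 0 <= m0.
Proof.
rewrite -lee_fin -phi_mass; apply: integral_ge0 => y _.
by rewrite lee_fin; case/andP: (phi01 y).
Qed.

Let v s y := expR (lam * s) * u s y.

Let v_bounds s y : 0 <= s -> 0 <= v s y <= expR (lam * s).
Proof.
move=> s0; have /andP[u0 u1] := mild_itv01 u_mild y s0.
by rewrite /v mulr_ge0 ?expR_ge0// ler_piMr ?expR_ge0.
Qed.

Let measurable_v s : 0 <= s -> measurable_fun setT (v s).
Proof.
move=> s0; apply: measurable_funM => //.
exact: (measurable_mild u_mild s0).
Qed.

Let heat_v t s x : 0 <= s ->
  heat (t - s) (v s) x = expR (lam * s) * backward u t s x.
Proof.
move=> s0; apply/EFin_inj.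
rewrite (heatE _ _ (measurable_v s0) (fun y => v_bounds y s0)) EFinM.
rewrite /backward (heatE _ _ (measurable_mild u_mild s0)
  (fun y => mild_itv01 u_mild y s0)) -eheatZ//.
- by apply/measurable_EFinP; exact: (measurable_mild u_mild s0).
- by move=> y; rewrite lee_fin; case/andP: (mild_itv01 u_mild y s0).
Qed.

Let integral_v_fin s : 0 <= s -> (\int[leb]_y (v s y)%:E)%E \is a fin_num.
Proof.
move=> s0; have [B [B0 vB _]] :=
  backward_growth_late d_ge1 q_law mphi phi01 phi_mass u_mild.
have v0 y : 0 <= v s y by case/andP: (v_bounds y s0).
rewrite ge0_fin_numE; last by apply: integral_ge0 => y _; rewrite lee_fin.
apply: (@le_lt_trans _ _ (\int[leb]_y (B%:E * (heat s phi y)%:E))%E).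
  apply: ge0_le_integral => //.
  - by move=> y _; rewrite lee_fin.
  - by apply/measurable_EFinP; exact: measurable_v.
  - apply: measurable_funeM; apply/measurable_EFinP.
    exact: (measurable_heat _ mphi phi01).
  - by move=> y _; rewrite -EFinM lee_fin vB.
rewrite ge0_integralZl//.
- by rewrite (integral_heat _ mphi phi01) phi_mass -EFinM ltry.
- by apply/measurable_EFinP; exact: (measurable_heat _ mphi phi01).
- by move=> y _; rewrite lee_fin heat_ge0.
Qed.

Let mass s := fine (\int[leb]_y (v s y)%:E)%E.

Let massE s : 0 <= s -> (\int[leb]_y (v s y)%:E = (mass s)%:E)%E.
Proof. by move=> s0; rewrite /mass fineK// integral_v_fin. Qed.

(** Integrating in space the pointwise comparison between the solution at time
    [t] and the heat flow of the solution at time [s]. *)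
Let mass_incr s t e : 0 <= s -> s <= t -> 0 <= e ->
  (forall x, v t x <= heat (t - s) (v s) x + e * heat t phi x) ->
  mass t <= mass s + e * m0.
Proof.
move=> s0 st e0 vh; have t0 := le_trans s0 st.
rewrite -lee_fin EFinD EFinM -!massE// -phi_mass.
rewrite -(integral_heat t mphi phi01).
rewrite -(integral_heat (t - s) (measurable_v s0) (fun y => v_bounds y s0)).
have mh : measurable_fun setT (fun x => (heat t phi x)%:E).
  by apply/measurable_EFinP; exact: (measurable_heat _ mphi phi01).
have mhv : measurable_fun setT (fun x => (heat (t - s) (v s) x)%:E).
  apply/measurable_EFinP.
  exact: (measurable_heat _ (measurable_v s0) (fun y => v_bounds y s0)).
have hv0 x : 0 <= heat (t - s) (v s) x.
  by rewrite heat_v// mulr_ge0 ?expR_ge0// (backward_ge0 u_mild).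
have h0 x : 0 <= heat t phi x by exact: heat_ge0.
rewrite -ge0_integralZl//; last by move=> x _; rewrite lee_fin.
rewrite -ge0_integralD//; first last.
- exact: measurable_funeM.
- by move=> x _; rewrite -EFinM lee_fin mulr_ge0.
- by move=> x _; rewrite lee_fin.
apply: ge0_le_integral => //.
- by move=> x _; rewrite lee_fin; case/andP: (v_bounds x t0).
- by apply/measurable_EFinP; exact: measurable_v.
- by apply: emeasurable_funD => //; exact: measurable_funeM.
- by move=> x _; rewrite -EFinM -EFinD lee_fin.
Qed.

Let mass_nd s t : 0 <= s -> s <= t -> mass s <= mass t.
Proof.
move=> s0 st; have t0 := le_trans s0 st.
rewrite -lee_fin -!massE//.
rewrite -(integral_heat (t - s) (measurable_v s0) (fun y => v_bounds y s0)).
apply: ge0_le_integral => //.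
- move=> x _; rewrite lee_fin heat_v// mulr_ge0 ?expR_ge0//.
  exact: (backward_ge0 u_mild).
- apply/measurable_EFinP.
  exact: (measurable_heat _ (measurable_v s0) (fun y => v_bounds y s0)).
- by apply/measurable_EFinP; exact: measurable_v.
move=> x _; rewrite lee_fin heat_v// /v -(backward_diag u).
exact: (backward_growth q_law mphi phi01 u_mild).
Qed.

Let mass0 : mass 0 = m0.
Proof.
apply/EFin_inj; rewrite -massE// -phi_mass; apply: eq_integral => y _.
rewrite /v mulr0 expR0 mul1r -(backward_diag u) (backward0 q_law mphi phi01 u_mild).
by rewrite /heat ltxx.
Qed.

(** The renormalized total mass increases to a finite limit, which is the mass
    of the profile seen by the heat flow at large times. *)
Let limit_mass : exists2 C : R, 0 < C &
  forall e : R, 0 < e -> exists2 S, 0 <= S & forall s, S <= s ->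
    `|mass s - C * m0| <= e.
Proof.
have [B [B0 vB late]] :=
  backward_growth_late d_ge1 q_law mphi phi01 phi_mass u_mild.
pose A := [set mass s | s in [set s : R | 0 <= s]].
have ubA : ubound A (B * m0 + m0).
  move=> _ [s /= s0 <-]; have [S S0 SP] := late 1 ltr01.
  have massB r : 0 <= r -> mass r <= B * m0.
    move=> r0; rewrite -lee_fin -massE// EFinM -phi_mass.
    rewrite -(integral_heat r mphi phi01) -ge0_integralZl//; first last.
    - by move=> y _; rewrite lee_fin heat_ge0.
    - by apply/measurable_EFinP; exact: (measurable_heat _ mphi phi01).
    apply: ge0_le_integral => //.
    - by move=> y _; rewrite lee_fin; case/andP: (v_bounds y r0).
    - by apply/measurable_EFinP; exact: measurable_v.
    - apply: measurable_funeM; apply/measurable_EFinP.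
      exact: (measurable_heat _ mphi phi01).
    - by move=> y _; rewrite -EFinM lee_fin vB.
  by rewrite (le_trans (massB s s0))// lerDl.
have supA : has_sup A.
  split; first by exists (mass 0), 0 => //=.
  by exists (B * m0 + m0).
pose mi := sup A.
have mass_le s : 0 <= s -> mass s <= mi.
  by move=> s0; apply: ub_le_sup; [exact: supA.2|exists s].
have mi_le s b : 0 <= s -> (forall t, s <= t -> mass t <= b) -> mi <= b.
  move=> s0 tb; apply: ge_sup; first exact: supA.1.
  move=> _ [r /= r0 <-]; have [sr|/ltW rs] := leP s r; first exact: tb.
  by apply: (le_trans (mass_nd r0 rs)); exact: tb.
have cv (e : R) : 0 < e -> exists2 S, 0 <= S & forall s, S <= s -> `|mass s - mi| <= e.
  move=> e0; pose e1 := e / (m0 + 1).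
  have m10 : 0 < m0 + 1 by rewrite ltr_wpDl.
  have e10 : 0 < e1 by rewrite divr_gt0.
  have [S S0 SP] := late e1 e10; exists S => // s Ss.
  have s0 := le_trans S0 Ss.
  have := mass_le s s0; have : mi <= mass s + e1 * m0.
    apply: (mi_le s) => // t st; apply: mass_incr => //; first exact: ltW.
    by move=> x; rewrite heat_v//; exact: SP.
  have : e1 * m0 <= e.
    rewrite /e1 mulrAC ler_pdivrMr// ler_wpM2l ?(ltW e0)//; lra.
  by rewrite ler_norml; move=> *; apply/andP; split; lra.
(* An initial datum of mass zero gives a solution of mass zero: any constant
   will do. *)
have := m0_ge0; rewrite le_eqVlt => /predU1P[m00|m00].
  exists 1 => // e e0; rewrite mul1r.
  suff -> : m0 = mi by exact: cv.
  apply/eqP; rewrite eq_le -{1}mass0 mass_le//=.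
  apply: ge_sup; first exact: supA.1.
  move=> _ [s /= s0 <-]; rewrite -lee_fin -massE// -phi_mass.
  rewrite -(integral_heat s mphi phi01).
  have zero : (\int[leb]_x (B%:E * (heat s phi x)%:E) = 0)%E.
    rewrite ge0_integralZl//.
    - by rewrite (integral_heat _ mphi phi01) phi_mass -m00 mule0.
    - by apply/measurable_EFinP; exact: (measurable_heat _ mphi phi01).
    - by move=> y _; rewrite lee_fin heat_ge0.
  rewrite (integral_heat _ mphi phi01) phi_mass -m00.
  apply: (@le_trans _ _ (\int[leb]_x (B%:E * (heat s phi x)%:E))%E); last by rewrite zero.
  apply: ge0_le_integral => //.
  - by move=> y _; rewrite lee_fin; case/andP: (v_bounds y s0).
  - by apply/measurable_EFinP; exact: measurable_v.
  - apply: measurable_funeM; apply/measurable_EFinP.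
    exact: (measurable_heat _ mphi phi01).
  - by move=> y _; rewrite -EFinM lee_fin vB.
exists (mi / m0); first by rewrite divr_gt0// (lt_le_trans m00)// -{1}mass0 mass_le.
by rewrite divfK ?gt_eqF.
Qed.

(** The theorem for one particle. The solution at a large time [t] is the heat
    flow of its value at a fixed late time [S], up to a small relative error. The
    heat flow only remembers the mass of that value, which is nearly [C] times the
    mass of [phi]. *)
Lemma mild_asymptotics : exists2 C : R, 0 < C &
  forall e : R, 0 < e -> exists2 T : R, 1 <= T & forall t x, T <= t ->
    t `^ (d%:R / 2) * `|expR (lam * t) * u t x - C * heat t phi x| <= e.
Proof.
have [B [B0 vB late]] :=
  backward_growth_late d_ge1 q_law mphi phi01 phi_mass u_mild.
have [C C0 massC] := limit_mass; exists C => // e e0.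
(* [t^(d/2)] is at most [a * (t - S)^(d/2)] as soon as [t] exceeds [2 * S]. *)
pose a : R := 2 `^ (d%:R / 2).
have a0 : 0 < a by rewrite powR_gt0.
pose e1 := e / (4 * (m0 + 1)); pose e2 := e / (4 * a); pose e3 := e2 / C.
have m10 : 0 < m0 + 1 by rewrite ltr_wpDl.
have e10 : 0 < e1 by rewrite divr_gt0// mulr_gt0.
have e20 : 0 < e2 by rewrite divr_gt0// mulr_gt0.
have e30 : 0 < e3 by rewrite divr_gt0.
have [S1 S10 S1P] := late e1 e10; have [S2 S20 S2P] := massC e2 e20.
pose S := Num.max S1 S2.
have S0 : 0 <= S by rewrite le_max S10.
have S1S : S1 <= S by rewrite le_max lexx.
have S2S : S2 <= S by rewrite le_max lexx orbT.
pose pS := heat S phi.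
have mpS : measurable_fun setT pS by exact: (measurable_heat _ mphi phi01).
have pS01 y : 0 <= pS y <= 1 by rewrite heat_ge0//= heat_le1.
have pS_mass : (\int[leb]_y (pS y)%:E = m0%:E)%E.
  by rewrite (integral_heat _ mphi phi01).
have [T1 T11 T1P] := heat_asymptotics (measurable_v S0)
  (fun y => v_bounds y S0) (massE S0) e20.
have [T2 T21 T2P] := heat_asymptotics mpS pS01 pS_mass e30.
exists (S + S + T1 + T2) => [|t x Tt]; first by lra.
pose r := t - S.
have [r1 r2 rS St] : [/\ T1 <= r, T2 <= r, t <= 2 * r & S <= t].
  by rewrite /r; split; lra.
have r0 : 0 < r by lra.
have t0 : 0 < t by lra.
have ta : t `^ (d%:R / 2) <= a * r `^ (d%:R / 2).
  rewrite /a -powRM//; last exact: ltW.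
  apply: ge0_ler_powR => //.
    by rewrite nnegrE ltW.
  by rewrite nnegrE mulr_ge0// ltW.
have pt : heat t phi x = heat r pS x.
  apply/EFin_inj; rewrite (heatE _ _ mpS pS01) (heatE _ _ mphi phi01).
  rewrite -(subrK S t) -eheat_eheat//; first last.
  - by move=> y; rewrite lee_fin; case/andP: (phi01 y).
  - exact/measurable_EFinP.
  - exact: ltW.
  by apply: eq_eheat => y; rewrite /= /pS (heatE _ _ mphi phi01).
have vt1 : v t x <= heat r (v S) x + e1 * heat t phi x.
  by rewrite /r heat_v//; exact: S1P.
have vt2 : heat r (v S) x <= v t x.
  rewrite /r heat_v// /v -(backward_diag u).
  exact: (backward_growth q_law mphi phi01 u_mild).
have K0 : 0 <= ker r x by exact: heat_kernel_ge0.
(* The solution at time [t] is compared with the heat flow, during the time [r],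
   of the solution at time [S]; this and the heat flow of [pS] are both close to
   a multiple of the same heat kernel. *)
have D : `|v t x - C * heat t phi x| <= e1 * heat t phi x +
    (`|heat r (v S) x - mass S * ker r x| + e2 * ker r x +
     C * `|heat r pS x - m0 * ker r x|).
  have -> : v t x - C * heat t phi x = (v t x - heat r (v S) x) +
      ((heat r (v S) x - mass S * ker r x) + (mass S - C * m0) * ker r x -
       C * (heat r pS x - m0 * ker r x)) by rewrite pt; ring.
  rewrite (le_trans (ler_normD _ _))// lerD//.
    by rewrite ger0_norm; lra.
  rewrite (le_trans (ler_normB _ _))// lerD//; last first.
    by rewrite normrM gtr0_norm.
  rewrite (le_trans (ler_normD _ _))// lerD2l normrM (ger0_norm K0).
  by rewrite ler_wpM2r// S2P.
have P1 : t `^ (d%:R / 2) * heat t phi x <= m0.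
  have := heat_le_mass x t0 mphi phi01 phi_mass => h.
  apply: (le_trans (ler_wpM2l (powR_ge0 _ _) h)).
  by rewrite mulrA ler_piMl// powR_mul_heat_peak_le1.
have P2 : r `^ (d%:R / 2) * ker r x <= 1.
  apply: (le_trans (ler_wpM2l (powR_ge0 _ _) (heat_kernel_le x r0))).
  exact: powR_mul_heat_peak_le1.
have P3 := T1P r x r1; have P4 := T2P r x r2.
set X := `|heat r (v S) x - mass S * ker r x| in D P3.
set Y := `|heat r pS x - m0 * ker r x| in D P4.
have X0 : 0 <= X by exact: normr_ge0.
have Y0 : 0 <= Y by exact: normr_ge0.
set tp := t `^ (d%:R / 2) in ta P1 *; set rp := r `^ (d%:R / 2) in ta P2 P3 P4 *.
have tp0 : 0 <= tp by exact: powR_ge0.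
apply: (le_trans (ler_wpM2l tp0 D)); rewrite mulrDr.
have Q1 : tp * (e1 * heat t phi x) <= e / 4.
  rewrite mulrCA; apply: (le_trans (ler_wpM2l (ltW e10) P1)).
  rewrite /e1 invfM mulrA mulrAC ler_pdivrMr// ler_wpM2l//; last by lra.
  by rewrite divr_ge0// ltW.
have W0 : 0 <= X + e2 * ker r x + C * Y.
  by rewrite !addr_ge0// mulr_ge0// ltW.
have Q2 : tp * (X + e2 * ker r x + C * Y) <= a * (3 * e2).
  apply: (le_trans (ler_wpM2r W0 ta)); rewrite -mulrA ler_wpM2l ?(ltW a0)//.
  have -> : rp * (X + e2 * ker r x + C * Y) =
      rp * X + e2 * (rp * ker r x) + C * (rp * Y).
    by ring.
  have Z2 := ler_wpM2l (ltW e20) P2.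
  have Z3 := ler_wpM2l (ltW C0) P4.
  have Z4 : C * e3 = e2 by rewrite /e3 mulrC divfK// gt_eqF.
  by rewrite Z4 in Z3; lra.
have Q3 : a * (3 * e2) = 3 * (e / 4) by rewrite /e2; field; rewrite gt_eqF.
by rewrite Q3 in Q2; lra.
Qed.

End one_particle.

(** * Several particles *)

(** The supremum over the second variable is the required majorant; [0] is added
    to the set so that it is nonempty. *)
Lemma uniform_limit_majorant (R : realType) (I : Type) (F : R -> I -> R) :
  (forall e : R, 0 < e -> exists T, forall t i, T <= t -> F t i <= e) ->
  exists2 eps : R -> R, eps t @[t --> +oo] --> (0 : R) &
  \forall t \near +oo, 0 <= eps t /\ forall i, F t i <= eps t.
Proof.
move=> F_small; pose A t := [set r | r = 0 \/ exists i, r = F t i].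
have A0 t : A t 0 by left.
have A_ub (e : R) T t : 0 <= e -> (forall t i, T <= t -> F t i <= e) -> T <= t ->
    ubound (A t) e.
  by move=> e0 FT Tt _ [->|[i ->]] //; exact: FT.
exists (fun t => sup (A t)).
  apply/cvgrPdist_le => e e0; have [T FT] := F_small e e0.
  near=> t; have Tt : T <= t by near: t; apply: nbhs_pinfty_ge; rewrite num_real.
  have At := A_ub e T t (ltW e0) FT Tt.
  rewrite sub0r normrN ger0_norm.
    by apply: ge_sup => //; exists 0.
  by apply: ub_le_sup => //; exists e.
have [T FT] := F_small 1 ltr01; near=> t.
have Tt : T <= t by near: t; apply: nbhs_pinfty_ge; rewrite num_real.
have At := A_ub 1 T t ler01 FT Tt.
have ubt : has_ubound (A t) by exists 1.
split; first exact: ub_le_sup.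
by move=> i; apply: ub_le_sup => //; right; exists i.
Unshelve. all: by end_near. Qed.

(** A second particle [y] contributes one more small factor, and further
    particles contribute factors at most [1]. *)
Lemma prod_cons_bound (R : realType) (T : eqType) (a b : R) (f : T -> R) y s :
  0 <= a -> (forall z, 0 <= f z <= 1) -> f y <= b ->
  0 <= a * \prod_(z <- y :: s) f z <= a * b.
Proof.
move=> a0 f01 fyb; have fy0 : 0 <= f y by case/andP: (f01 y).
have [p0 p1] : 0 <= \prod_(z <- s) f z /\ \prod_(z <- s) f z <= 1.
  split; first by apply: prodr_ge0 => z _; case/andP: (f01 z).
  by apply: prodr_ile1 => z _; exact: f01.
rewrite big_cons !mulr_ge0//= ler_wpM2l// (le_trans _ fyb)//.
by rewrite ler_piMr.
Qed.

Theorem theorem3p1 (R : realType) (d : nat) (d_ge1 : (1 <= d)%N)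
    (q : nat -> R) (q_law : offspring_law q)
    (H : R -> R.-pker config R d ~> config R d)
    (H_branching : branching_transition q H)
    (phi : 'rV[R]_d -> R)
    (phi_L1 : (@lebesgue_rV R d).-integrable [set: 'rV[R]_d] (EFin \o phi))
    (phi01 : forall x, 0 <= phi x <= 1) :
  exists2 C : R, 0 < C &
  exists2 eps : R -> R, eps t @[t --> +oo] --> (0 : R) &
  \forall t \near +oo, forall mu : config R d, mu != mset0 ->
    t `^ (d%:R / 2) *
      `| expR (t * (1 - q 1%N)) * (\int[H t mu]_nu hat phi nu)
         - hat (fun=> C) mu * (\int[brownian t mu]_nu hat phi nu) |
    <= (l1 mu)%:R * eps t.
Proof.
have mphi : measurable_fun setT phi.
  by apply/measurable_EFinP; case/integrableP: phi_L1.
have [_ _ /(_ phi mphi phi01)[u u_mild Hu]] := H_branching.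
pose m0 := fine (\int[@lebesgue_rV R d]_y (phi y)%:E)%E.
have phi_mass : (\int[@lebesgue_rV R d]_y (phi y)%:E = m0%:E)%E.
  by rewrite /m0 fineK//; exact: integrable_fin_num phi_L1.
have m0_ge0 : 0 <= m0.
  rewrite -lee_fin -phi_mass; apply: integral_ge0 => y _.
  by rewrite lee_fin; case/andP: (phi01 y).
have [C C0 one] := mild_asymptotics d_ge1 q_law mphi phi01 phi_mass u_mild.
have [B [B0 vB _]] :=
  backward_growth_late d_ge1 q_law mphi phi01 phi_mass u_mild.
exists C => //.
pose lam := 1 - q 1%N.
pose I := {mu : config R d | mu != mset0}.
pose F t (mu : I) := t `^ (d%:R / 2) *
  `|expR (lam * t) * hat (u t) (val mu) -
    hat (fun=> C) (val mu) * hat (heat t phi) (val mu)|.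
suff [eps eps0 Feps] : exists2 eps : R -> R, eps t @[t --> +oo] --> (0 : R) &
    \forall t \near +oo, 0 <= eps t /\ forall i, F t i <= eps t.
  exists eps => //; near=> t => mu mu0.
  have t0 : 0 < t by near: t; apply: nbhs_pinfty_gt; rewrite num_real.
  have [e0 Fe] : 0 <= eps t /\ forall i, F t i <= eps t by near: t.
  rewrite Hu; last exact: ltW.
  rewrite (integral_brownian mu t0 mphi phi01) (mulrC t).
  apply: (le_trans (Fe (exist _ mu mu0))).
  by rewrite ler_peMl// ler1n /l1 lt0n size_mset_eq0.
apply: uniform_limit_majorant => e e0.
(* With at least two particles both products are small: the first particle
   contributes the order [t^(-d/2)], the second one at most [dl], and [C * dl]
   is at most [1]. *)
pose b := B * m0 + C * C * m0 + 1.
have b0 : 0 < b by rewrite ltr_wpDl// !addr_ge0// !mulr_ge0// ltW.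
pose dl := Num.min (e / b) C^-1.
have dl0 : 0 < dl by rewrite lt_min divr_gt0// invr_gt0.
have [T1 T11 T1P] := one e e0.
have [T2 T20 T2P] := heat_eventually_le d_ge1 mphi phi01 phi_mass dl0.
exists (T1 + T2) => t [mu mu0] Tt; rewrite /F/= /hat.
have t0 : 0 < t by lra.
rewrite -[X in _ - X]big_split/=.
have : (0 < size (enum_mset mu))%N by rewrite lt0n size_mset_eq0.
case: (enum_mset mu : seq _) => [//|x [_|y s _]].
  by rewrite !big_seq1; apply: T1P; lra.
have p_small z : heat t phi z <= dl by apply: T2P; lra.
have p0 z : 0 <= heat t phi z by exact: heat_ge0.
have Cp01 z : 0 <= C * heat t phi z <= 1.
  rewrite mulr_ge0 ?(ltW C0)//= -ler_pdivlMl// mulr1.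
  by rewrite (le_trans (p_small z))// ge_min lexx orbT.
have u01 z : 0 <= u t z <= 1 by exact: (mild_itv01 u_mild z (ltW t0)).
have ule z : u t z <= dl.
  apply: le_trans (p_small z).
  exact: (mild_le_heat q_law mphi phi01 u_mild z (ltW t0)).
have peak : t `^ (d%:R / 2) * heat t phi x <= m0.
  have h := heat_le_mass x t0 mphi phi01 phi_mass.
  apply: (le_trans (ler_wpM2l (powR_ge0 _ _) h)).
  by rewrite mulrA ler_piMl// powR_mul_heat_peak_le1.
rewrite big_cons [X in _ - X]big_cons mulrA.
have vx0 : 0 <= expR (lam * t) * u t x.
  by rewrite mulr_ge0 ?expR_ge0//; case/andP: (u01 x).
have Cx0 : 0 <= C * heat t phi x by case/andP: (Cp01 x).
have /andP[h1 h2] := prod_cons_bound s vx0 u01 (ule y).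
have Cdl : C * heat t phi y <= C * dl by rewrite ler_wpM2l// ltW.
have /andP[h3 h4] := prod_cons_bound s Cx0 Cp01 Cdl.
apply: (@le_trans _ _ (t `^ (d%:R / 2) *
    (expR (lam * t) * u t x * dl + C * heat t phi x * (C * dl)))).
  rewrite ler_wpM2l ?powR_ge0// ler_norml; apply/andP; split; lra.
apply: (@le_trans _ _ ((B * m0 + C * C * m0) * dl)); last first.
  have h5 : dl <= e / b by rewrite ge_min lexx.
  have n0 : 0 <= B * m0 + C * C * m0 by rewrite addr_ge0// !mulr_ge0// ltW.
  apply: (le_trans (ler_wpM2l n0 h5)).
  rewrite mulrCA ler_piMr ?(ltW e0)// ler_pdivrMr// mul1r /b; lra.
set tp := t `^ (d%:R / 2) in peak *.
have tp0 : 0 <= tp by exact: powR_ge0.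
have k1 : tp * (expR (lam * t) * u t x) <= B * m0.
  apply: (le_trans (ler_wpM2l tp0 (vB t x (ltW t0)))).
  by rewrite mulrCA ler_wpM2l.
have k2 : C * C * (tp * heat t phi x) <= C * C * m0.
  by rewrite ler_wpM2l// mulr_ge0// ltW.
have k3 := ler_wpM2r (ltW dl0) k1; have k4 := ler_wpM2r (ltW dl0) k2.
by lra.
Unshelve. all: by end_near. Qed.
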